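(* Let $\Sigma$ be a spacelike surface in the Lorentz-Minkowski space $\mathbb{L}^3$ such that $H_R=H_L$ at every point of $\Sigma$. Then $K_R\le 0$ everywhere on $\Sigma$. Moreover, for every $p\in\Sigma$, if $K_R(p)=0$ then $H_R(p)=0$. In particular, if the mean curvature $H_R(p)=H_L(p)$ at a point $p\in\Sigma$ does not vanish, then $\Sigma$ is locally non-convex at $p$.
   Context: $\mathbb{L}^3$ is $\mathbb{R}^3$ endowed with the metric $\langle\cdot,\cdot\rangle_L=dx_1^2+dx_2^2-dx_3^2$; $\langle\cdot,\cdot\rangle_R$ is the Euclidean metric of $\mathbb{R}^3$. The Levi-Civita connections of both metrics coincide and are denoted by $\overline\nabla$. A smooth connected surface $\Sigma\subset\mathbb{R}^3$ is spacelike if the metric induced on it by $\langle\cdot,\cdot\rangle_L$ is Riemannian. Let $N_L$ be the future-directed (positive third component) unit normal field of $\Sigma$ with respect to $\langle\cdot,\cdot\rangle_L$ (so $\langle N_L,N_L\rangle_L=-1$), and $N_R$ the upwards-directed unit normal field with respect to $\langle\cdot,\cdot\rangle_R$. The shape operators are $A_LX=-\overline\nabla_XN_L$ and $A_RX=-\overline\nabla_XN_R$. The mean curvatures are $H_L=-\frac12\mathrm{tr}\,A_L$ and $H_R=\frac12\mathrm{tr}\,A_R$, and the Euclidean Gaussian curvature is $K_R=\det A_R$. If $\Sigma$ is locally the graph of a smooth function $u$ with $|Du|<1$ over a domain of the plane $x_3=0$ (every spacelike surface locally is), then $H_L=\frac12\mathrm{div}\big(Du/\sqrt{1-|Du|^2}\big)$,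 $H_R=\frac12\mathrm{div}\big(Du/\sqrt{1+|Du|^2}\big)$ and $K_R=\det(D^2u)/(1+|Du|^2)^2$. The surface is locally non-convex at $p$ if no neighbourhood of $p$ in $\Sigma$ lies in one of the two closed half-spaces bounded by the (affine) tangent plane of $\Sigma$ at $p$. *)

(* Defs.v *)
From mathcomp Require Import all_boot all_order all_algebra.
From mathcomp Require Import all_classical all_reals all_analysis.

Set Implicit Arguments.
Unset Strict Implicit.
Unset Printing Implicit Defensive.

Import Order.TTheory GRing.Theory Num.Theory.
Import numFieldNormedType.Exports.

Local Open Scope classical_set_scope.
Local Open Scope ring_scope.

Section Smooth.
Context {R : realType} {V W : normedModType R}.

(* Only meaningful for [U] open, in which case the directional derivatives
   ['D_v f] at points of [U] depend only on the restriction of [f] to [U]. *)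
Fixpoint Ck_on (k : nat) (U : set V) (f : V -> W) : Prop :=
  match k with
  | 0 => forall x, U x -> {for x, continuous f}
  | k'.+1 => (forall x, U x -> differentiable f x) /\
             (forall v : V, Ck_on k' U ('D_v f))
  end.

Definition smooth_on (U : set V) (f : V -> W) : Prop :=
  forall k : nat, Ck_on k U f.

End Smooth.

Section Metrics.
Context {R : realType}.
Implicit Types u v : 'rV[R]_3.

Definition x3 u : R := u 0 ord_max.

Definition dotR u v : R := u 0 0 * v 0 0 + u 0 1 * v 0 1 + x3 u * x3 v.

Definition dotL u v : R := u 0 0 * v 0 0 + u 0 1 * v 0 1 - x3 u * x3 v.

End Metrics.

Section RestrictedEndomorphism.
Context {R : realType}.

(* The matrix, in a basis of [T], of the endomorphism of [T] induced by a map
   [A] that is linear on [T] and sends [T] to itself.  Its trace and its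
   determinant do not depend on the basis. *)
Definition restr_mx (T : {vspace 'rV[R]_3}) (A : 'rV[R]_3 -> 'rV[R]_3) :
    'M[R]_(\dim T) :=
  \matrix_(i, j) coord (vbasis T) j (A (vbasis T)`_i).

Definition restr_tr T A : R := \tr (restr_mx T A).

Definition restr_det T A : R := \det (restr_mx T A).

End RestrictedEndomorphism.

Section Surfaces.
Context {R : realType}.
Implicit Types (Sigma : set 'rV[R]_3) (p v w n : 'rV[R]_3).

(* [X : U -> Sigma `&` V] is a local parametrization of [Sigma]: a smooth immersion
   that is a homeomorphism (with inverse [Y]) onto a relatively open subset
   of [Sigma]. *)
Definition local_param Sigma (U : set 'rV[R]_2) (V : set 'rV[R]_3)
    (X : 'rV[R]_2 -> 'rV[R]_3) (Y : 'rV[R]_3 -> 'rV[R]_2) : Prop :=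
  [/\ open U /\ open V,
      smooth_on U X,
      X @` U = Sigma `&` V,
      (forall q, U q -> Y (X q) = q) /\ {within Sigma `&` V, continuous Y} &
      forall q, U q -> injective ('d X q)].

Definition smooth_surface Sigma : Prop :=
  connected Sigma /\
  forall p, Sigma p -> exists U V X Y, local_param Sigma U V X Y /\ V p.

Definition curve_in Sigma p v (g : R^o -> 'rV[R]_3) : Prop :=
  exists I : set R^o,
    [/\ open I /\ I 0, smooth_on I g, g @` I `<=` Sigma, g 0 = p & 'D_1 g 0 = v].

(* The set of velocities at [p] of the curves in [Sigma] is a linear subspace when
   [Sigma] is a smooth surface; this is that subspace. *)
Definition tangent_space Sigma p : {vspace 'rV[R]_3} :=
  xget 0%VS [set T : {vspace 'rV[R]_3} |
    forall v, v \in T <-> exists g, curve_in Sigma p v g].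

Definition spacelike_surface Sigma : Prop :=
  smooth_surface Sigma /\
  forall p v, Sigma p -> v \in tangent_space Sigma p -> v != 0 -> 0 < dotL v v.

Definition N_L Sigma p : 'rV[R]_3 :=
  xget 0 [set n | [/\ dotL n n = - 1,
    forall v, v \in tangent_space Sigma p -> dotL n v = 0 & 0 < x3 n]].

Definition N_R Sigma p : 'rV[R]_3 :=
  xget 0 [set n | [/\ dotR n n = 1,
    forall v, v \in tangent_space Sigma p -> dotR n v = 0 & 0 < x3 n]].

(* The flat connection of R^3: the derivative at [p], in the tangent direction
   [v], of a vector field [N] along [Sigma], computed along a curve in [Sigma] with
   velocity [v] (the result does not depend on the curve). *)
Definition nabla Sigma (N : 'rV[R]_3 -> 'rV[R]_3) p v : 'rV[R]_3 :=
  xget 0 [set w | exists g : R^o -> 'rV[R]_3,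
    curve_in Sigma p v g /\ is_derive (0 : R^o) (1 : R^o) (N \o g) w].

Definition A_L Sigma p v : 'rV[R]_3 := - nabla Sigma (N_L Sigma) p v.

Definition A_R Sigma p v : 'rV[R]_3 := - nabla Sigma (N_R Sigma) p v.

Definition H_L Sigma p : R := - (2^-1 * restr_tr (tangent_space Sigma p) (A_L Sigma p)).

Definition H_R Sigma p : R := 2^-1 * restr_tr (tangent_space Sigma p) (A_R Sigma p).

Definition K_R Sigma p : R := restr_det (tangent_space Sigma p) (A_R Sigma p).

(* The closed half-spaces bounded by the affine tangent plane at [p], whose
   Euclidean normal is [N_R Sigma p]. *)
Definition upper_half_space Sigma p : set 'rV[R]_3 :=
  [set x | 0 <= dotR (x - p) (N_R Sigma p)].

Definition lower_half_space Sigma p : set 'rV[R]_3 :=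
  [set x | dotR (x - p) (N_R Sigma p) <= 0].

Definition locally_nonconvex Sigma p : Prop :=
  ~ exists2 V : set 'rV[R]_3, nbhs p V &
      Sigma `&` V `<=` upper_half_space Sigma p \/ Sigma `&` V `<=` lower_half_space Sigma p.

End Surfaces.

(* Main.v *)
Require Import Defs.
From mathcomp Require Import all_boot all_order all_algebra.
From mathcomp Require Import all_classical all_reals all_analysis.
From mathcomp Require Import ring lra.

Import Order.TTheory GRing.Theory Num.Theory.
Import numFieldNormedType.Exports.

Local Open Scope classical_set_scope.
Local Open Scope ring_scope.

Set Implicit Arguments.
Unset Strict Implicit.
Unset Printing Implicit Defensive.

(** Near each of its points the surface is parametrized by some X : U -> R^3.
Let (p, q) be the slope of its tangent plane over the plane x3 = 0, that is the
gradient of the height function whose graph the surface locally is, and let S be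
the Hessian of that height function.  With r2 = p^2 + q^2 < 1, a = sqrt (1 + r2),
b = sqrt (1 - r2), D = tr S and Q = S(grad, grad), the curvatures are
   2 H_R = D / a - Q / a^3,   2 H_L = D / b + Q / b^3,   K_R = det S / a^4
([curvatures_param]).  As a - b = 2 r2 / (a + b), the equation H_R = H_L says that
Q = - m r2 D for some m >= b^2 / (2 a^2) ([mean_curvature_eq]).  Where r2 <> 0, the
second derivative of the height is therefore - m D along the gradient and
(1 + m) D across it; these have opposite signs, so det S <= - m D^2, and hence
   2 a^2 det S + b^2 D^2 <= 0
([hessian_det_le]).  At a point where r2 = 0 the equation H_R = H_L holds for free
and carries no information, but the left-hand side of the inequality is continuous.
Were it positive there, it would be positive on a neighbourhood, on which r2 would
then vanish; the slopes being locally constant, S would be 0, a contradiction.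
So the inequality holds everywhere ([defect_le0]).

It gives det S <= 0, and if det S = 0 then D = 0, whence Q = 0 and H_R = 0.  If
H_R <> 0 then det S < 0, so S is indefinite and the height above the tangent plane
decreases along one line of parameters and increases along another
([height_decreases]).

The surface is never rewritten as an actual graph, which would require a smooth
inverse function theorem: p, q and S are expressed through the partial derivatives of
X by Cramer's rule.  The link with the intrinsic definitions is that a curve
drawn on the surface lifts to a differentiable curve of parameters ([curve_lift]),
so that the tangent space is the image of the differential of X and every derivative
along the surface is a derivative in the parameters.  Besides this, the proof uses
the symmetry of S, that is of the second derivatives of X ([mixed_derivatives_eq]). *)

(** * Differentiability along lines and through local lifts *)

Section Ck.
Context {R : realType} {V W : normedModType R}.

Lemma near_eq_differentiable (f g : V -> W) x :
  {near x, f =1 g} -> differentiable f x -> differentiable g x.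
Proof.
move=> fg df.
have dg : g \o shift x = cst (g x) + 'd f x +o_ 0 id.
  apply/eqaddoP => e e0; have /eqaddoP/(_ e e0) := diff_locally df.
  have := fg; rewrite (near_shift 0 x) /= => fg0.
  apply: filterS2 fg0 => t /=; rewrite subr0 => fgt.
  by rewrite !fctE /= fgt -(nbhs_singleton fg).
apply/diff_locallyP; rewrite (diff_unique (diff_continuous df) dg).
by split=> //; exact: diff_continuous.
Qed.

Lemma is_derive0P (f : R^o -> W) (w : W) :
  is_derive (0 : R^o) (1 : R^o) f w <->
  forall e : R, 0 < e -> \forall t \near (0 : R^o), `|f t - f 0 - t *: w| <= e * `|t|.
Proof.
split=> [[df <-] e e0|h].
  have := (derivable_nbhsP _ _ _).1 df => /eqaddoP/(_ e e0).
  apply: filterS => t; rewrite !fctE /= addr0 opprD addrA.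
  by rewrite [t%:A]mulr1.
have cv : (fun h => h^-1 *: ((f \o shift 0) (h *: (1 : R^o)) - f 0)) @ 0^' --> w.
  apply/cvgrPdist_le => e e0; rewrite near_withinE.
  apply: filterS (h e e0) => t ht t0 /=.
  rewrite addr0 [t%:A]mulr1 distrC -[X in _ - X](scalerK t0) -scalerBr normrZ.
  by rewrite normfV ler_pdivrMl ?normr_gt0// mulrC.
by split; [apply/cvg_ex; exists w | exact: cvg_lim cv].
Qed.

(** On an open set a derivative sees only the values on that set, so the recursive
definition of C^k depends only on these values too. *)
Lemma Ck_on_ext k (U : set V) (f g : V -> W) : open U ->
  (forall x, U x -> f x = g x) -> Ck_on k U f -> Ck_on k U g.
Proof.
move=> oU; elim: k f g => [|k IH] f g fg /=.
  move=> cf x Ux; have nfg : {near x, f =1 g}.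
    by move: (open_nbhs_nbhs (conj oU Ux)); apply: filterS.
  rewrite /prop_for /continuous_at -(fg _ Ux).
  by apply: cvg_trans (cf _ Ux); apply: near_eq_cvg; move: nfg; apply: filterS.
move=> [df Df].
have nfg x : U x -> {near x, f =1 g}.
  by move=> Ux; move: (open_nbhs_nbhs (conj oU Ux)); apply: filterS.
split=> [x Ux|v].
  exact: near_eq_differentiable (nfg _ Ux) (df _ Ux).
by apply: IH (Df v) => x Ux; exact/near_eq_derive/nfg.
Qed.

Definition line (s w : V) : R^o -> V := fun t => t *: w + s.

Lemma is_derive_line (s w : V) (t h : R^o) : is_derive t h (line s w) (h *: w).
Proof.
have D : is_diff t ( *:%R ^~ w : R^o -> V) ( *:%R ^~ w) by exact: is_diff_scalel.
have Dw : is_derive t h ( *:%R ^~ w : R^o -> V) (h *: w).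
  split; first by apply: diff_derivable; exact: ex_diff.
  by rewrite deriveE; [rewrite (@diff_val _ _ _ _ _ _ _ D) | exact: ex_diff].
exact: is_derive_eq (is_deriveD Dw (is_derive_cst s t h)) (addr0 _).
Qed.

Lemma differentiable_line (s w : V) t : differentiable (line s w) t.
Proof. by apply/derivable1_diffP; have [] := is_derive_line s w t 1. Qed.

Lemma is_derive1_line (s w : V) (t : R^o) :
  is_derive t (1 : R^o) (line s w) w.
Proof. exact: is_derive_eq (is_derive_line _ _ _ _) (scale1r w). Qed.

Lemma line0 (s w : V) : line s w 0 = s.
Proof. by rewrite /line scale0r add0r. Qed.

Lemma open_line (s w : V) (U : set V) : open U -> open (line s w @^-1` U).
Proof.
move=> oU; apply: open_comp => // t _.
exact/differentiable_continuous/differentiable_line.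
Qed.

Lemma smooth_on_differentiable (U : set V) (f : V -> W) x :
  smooth_on U f -> U x -> differentiable f x.
Proof. by move=> /(_ 1%N)[+ _] Ux; exact. Qed.

Lemma smooth_on_derive (U : set V) (f : V -> W) v :
  smooth_on U f -> smooth_on U ('D_v f).
Proof. by move=> smf k; case: (smf k.+1) => _; exact. Qed.

Lemma differentiable_is_derive (f : V -> W) x v : differentiable f x ->
  is_derive x v f ('d f x v).
Proof. by move=> df; split; [exact: diff_derivable | rewrite deriveE]. Qed.

End Ck.

Section Chain.
Context {R : realType} {U V W : normedModType R}.

Lemma is_derive_comp (y : U -> V) (F : V -> W) a h w :
  differentiable y a -> is_derive a h y w ->
  differentiable F (y a) -> is_derive a h (F \o y) ('d F (y a) w).
Proof.
move=> dy [_ <-] dF.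
have dFy := differentiable_comp dy dF.
split; first exact: diff_derivable.
by rewrite !deriveE// diff_comp.
Qed.

End Chain.

Section CkLine.
Context {R : realType} {V W : normedModType R}.

(** The derivative in direction h of f composed with a line of velocity w is the
derivative of f in direction h *: w composed with the same line, at the times when
the line is in U; the class C^k therefore passes to the composite by induction. *)
Lemma Ck_on_line k (U : set V) (f : V -> W) s w : open U ->
  Ck_on k U f -> Ck_on k (line s w @^-1` U) (f \o line s w).
Proof.
move=> oU; elim: k f => [|k IH] f /=.
  move=> cf t Ut; apply: continuous_comp; last exact: cf.
  exact/differentiable_continuous/differentiable_line.
move=> [df Df]; split=> [t Ut|h].
  by apply: differentiable_comp; [exact: differentiable_line|exact: df].
apply: Ck_on_ext (IH _ (Df (h *: w))); first exact: open_line.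
move=> t Ut /=; rewrite deriveE; last exact: df.
apply/esym; apply: (@derive_val _ _ _ _ _ _ _ (is_derive_comp _ _ _)).
- exact: differentiable_line.
- exact: is_derive_line.
- exact: df.
Qed.

End CkLine.

(** A linear map on row vectors is a finite combination of coordinate forms. *)
Lemma linear_rV_continuous (R : realType) n (W : normedModType R)
  (f : {linear 'rV[R]_n -> W}) : continuous f.
Proof.
have -> : (f : _ -> _) = \sum_(i < n) (fun u : 'rV[R]_n => u 0 i *: f (delta_mx 0 i)).
  apply/funext => u; rewrite [in LHS](row_sum_delta u) linear_sum fct_sumE.
  by apply: eq_bigr => i _; rewrite linearZ.
move=> u; apply: differentiable_continuous; apply: differentiable_sum => i.
apply: differentiableZl; exact: differentiable_coord.
Qed.

Section Lift.
Context {R : realType} {V W : normedModType R}.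

(** A linear left inverse L of the differential of F plays the part of a local inverse:
applying L to the first-order expansions of F at a and of
g at 0 gives y t - a = t *: L v up to an error that is small compared with
|y t - a| + |t|.  With a relative error 1/2 this bounds y t - a by a multiple of t,
and the error is then small compared with t alone. *)
Lemma is_derive_lift (F : V -> W) (a : V) (L : {linear W -> V})
    (y : R^o -> V) (g : R^o -> W) v :
  differentiable F a -> continuous L -> (forall x, L ('d F a x) = x) ->
  {for 0, continuous y} -> y 0 = a ->
  (\forall t \near (0 : R^o), F (y t) = g t) ->
  is_derive (0 : R^o) (1 : R^o) g v ->
  is_derive (0 : R^o) (1 : R^o) y (L v).
Proof.
move=> dF cL LK cy y0 Fy /is_derive0P dg.
have [k k0 kL] := linear_lipschitz cL.
have key e : 0 < e -> \forall t \near (0 : R^o),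
   `|y t - a - t *: L v| <= e * (`|y t - a| + `|t|).
  move=> e0; have ek0 : 0 < e / k by rewrite divr_gt0.
  have := diff_locally dF => /eqaddoP/(_ _ ek0).
  rewrite near_simpl (near_shift a 0) /= => oF.
  have {}oF : \forall t \near (0 : R^o),
      `|F (y t) - F a - 'd F a (y t - a)| <= e / k * `|y t - a|.
    rewrite -y0 in oF *; have := cy _ oF.
    rewrite nbhs_simpl /=; apply: (@filterS _ (nbhs (0 : R^o))) => t.
    by rewrite /= sub0r !fctE /= subrK opprD addrA.
  have g0 : g 0 = F a by rewrite -y0 (nbhs_singleton Fy).
  have dge := dg _ ek0.
  near=> t.
  have H1 : `|F (y t) - F a - 'd F a (y t - a)| <= e / k * `|y t - a| by near: t.
  have H2 : `|g t - g 0 - t *: v| <= e / k * `|t| by near: t.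
  have H3 : F (y t) = g t by near: t.
  rewrite H3 in H1; rewrite g0 in H2.
  have -> : y t - a - t *: L v =
      L ((g t - F a - t *: v) - (g t - F a - 'd F a (y t - a))).
    have E (A b c : W) : (A - c) - (A - b) = b - c.
      by rewrite opprB [LHS]addrC subrKA.
    by rewrite E linearB/= LK [L (t *: v)]linearZZ.
  rewrite (le_trans (kL _))//.
  rewrite -ler_pdivlMl// (le_trans (ler_normB _ _))// (le_trans (lerD H2 H1))//.
  by rewrite [e / k]mulrC -mulrDr addrC mulrA.
apply/is_derive0P => e e0; rewrite y0.
(* [key] at 1/2 gives |y t - a| <= (C - 1) * |t|. *)
set C := 2 * `|L v| + 2.
have C0 : 0 < C by rewrite ltr_wpDl// mulr_ge0.
have h0 : 0 < e / C by rewrite divr_gt0.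
have h2 : 0 < (2^-1 : R) by rewrite invr_gt0.
have H1 := key _ h2; have H2 := key _ h0.
apply: filterS2 H1 H2 => t H1 H2.
rewrite (le_trans H2)// -mulrA ler_pM2l// ler_pdivrMl//.
have : `|y t - a| <= `|y t - a - t *: L v| + `|t| * `|L v|.
  by rewrite -normrZ -{1}(subrK (t *: L v) (y t - a)) ler_normD.
rewrite /C; nra.
Unshelve. all: by end_near. Qed.

End Lift.

(** * Consequences of the mean value theorem *)

Section MeanValue.
Context {R : realType} {V : normedModType R}.

Lemma is_derive_along (f : V -> R) (x v : V) (t : R) (d : R) :
  is_derive (t *: v + x) v f d ->
  is_derive (t : R^o) (1 : R^o) (fun u => f (u *: v + x)) d.
Proof.
have E : (fun h : R => h^-1 *: (((fun u => f (u *: v + x)) \o shift t) (h *: (1 : R^o))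
     - f (t *: v + x)))
   = (fun h : R => h^-1 *: ((f \o shift (t *: v + x)) (h *: v) - f (t *: v + x))).
  apply/funext => h /=; congr (_ *: (f _ - _)).
  by rewrite [h%:A]mulr1 scalerDl addrA.
move=> [df <-]; split.
  by move: df; rewrite /derivable/= E.
by rewrite /derive /= E.
Qed.

Lemma MVT0 (f df : R -> R) (h : R) : 0 < h ->
  (forall t : R, 0 <= t <= h -> is_derive (t : R^o) (1 : R^o) f (df t)) ->
  exists2 t, 0 < t < h & f h - f 0 = h * df t.
Proof.
move=> h0 D; have [t|t|t] := @MVT R f df 0 h h0.
- by rewrite in_itv/= => /andP[t0 th]; apply: D; rewrite !ltW.
- suff: {within `[0, h], continuous f} by apply.
  apply: derivable_within_continuous => t'; rewrite in_itv/= => th.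
  by have [] := D _ th.
by rewrite in_itv/= subr0 mulrC => th ->; exists t.
Qed.

(** The second difference over a parallelogram is a difference of increments in the
direction w, as a function of the position along v; the mean value theorem applies
first along v and then along w. *)
Lemma second_difference (U : set V) (f fv fvw : V -> R) (v w a : V) (h : R) :
  0 < h -> (forall s t : R, 0 <= s <= h -> 0 <= t <= h -> U (s *: v + (t *: w + a))) ->
  (forall x, U x -> is_derive x v f (fv x)) ->
  (forall x, U x -> is_derive x w fv (fvw x)) ->
  exists s t : R, [/\ 0 < s < h, 0 < t < h &
    f (h *: v + (h *: w + a)) - f (h *: v + a) - (f (h *: w + a) - f a) =
    h * (h * fvw (s *: v + (t *: w + a)))].
Proof.
move=> h0 Ust df dfv.
have h00 : 0 <= (0 : R) <= h by rewrite lexx ltW.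
have hh : 0 <= h <= h by rewrite lexx ltW.
have [s sh|s sh Es] := @MVT0 (fun s => f (s *: v + (h *: w + a)) - f (s *: v + a))
    (fun s => fv (s *: v + (h *: w + a)) - fv (s *: v + a)) h h0.
  apply: is_deriveB; apply: is_derive_along; apply: df; first exact: Ust.
  by have := Ust s 0 sh h00; rewrite scale0r add0r.
have sh' : 0 <= s <= h by case/andP: sh => *; rewrite !ltW.
have [t th|t th Et] := @MVT0 (fun t => fv (t *: w + (s *: v + a)))
    (fun t => fvw (t *: w + (s *: v + a))) h h0.
  by apply: is_derive_along; apply: dfv; rewrite addrCA; exact: Ust.
exists s, t; split=> //.
rewrite [s *: v + _]addrCA -Et scale0r add0r [h *: w + (s *: v + a)]addrCA -Es.
by rewrite !scale0r !add0r.
Qed.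

(** The second difference is symmetric in v and w, so [second_difference] equates
a value of fvw and a value of fwv at points arbitrarily close to a. *)
Lemma mixed_derivatives_eq (U : set V) (f fv fw fvw fwv : V -> R) (v w a : V) :
  open U -> U a ->
  (forall x, U x -> is_derive x v f (fv x)) ->
  (forall x, U x -> is_derive x w f (fw x)) ->
  (forall x, U x -> is_derive x w fv (fvw x)) ->
  (forall x, U x -> is_derive x v fw (fwv x)) ->
  {for a, continuous fvw} -> {for a, continuous fwv} -> fvw a = fwv a.
Proof.
move=> oU Ua dv dw dvw dwv cvw cwv.
apply/eqP; rewrite -subr_eq0 -normr_le0; apply/ler_addgt0Pr => e e0; rewrite add0r.
have eh0 : 0 < e / 2 by rewrite divr_gt0.
have [r /= r0 Br] : exists2 r, 0 < r & forall x, ball a r x ->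
    [/\ U x, `|fvw a - fvw x| < e / 2 & `|fwv a - fwv x| < e / 2].
  have : nbhs a [set x | [/\ U x, `|fvw a - fvw x| < e / 2 & `|fwv a - fwv x| < e / 2]].
    move/cvgrPdist_lt : cvw => /(_ _ eh0) n1; move/cvgrPdist_lt : cwv => /(_ _ eh0) n2.
    near=> x; split; [|by near: x..].
    by near: x; exact: open_nbhs_nbhs.
  by move/nbhs_ballP => [r r0 Br]; exists r.
pose h := r / (`|v| + `|w| + 1).
have N0 : 0 < `|v| + `|w| + 1 by rewrite ltr_wpDl// addr_ge0.
have h0 : 0 < h by rewrite divr_gt0.
have Bst s t : 0 <= s <= h -> 0 <= t <= h -> ball a r (s *: v + (t *: w + a)).
  move=> /andP[s0 sh] /andP[t0 th].
  rewrite -ball_normE /= addrA [X in a - X]addrC opprD addrA subrr sub0r normrN.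
  rewrite (le_lt_trans (ler_normD _ _))// !normrZ !ger0_norm//.
  have -> : r = h * (`|v| + `|w| + 1) by rewrite divfK// gt_eqF.
  by have := normr_ge0 v; have := normr_ge0 w; nra.
have UB1 s t : 0 <= s <= h -> 0 <= t <= h -> U (s *: v + (t *: w + a)).
  by move=> sh th; have [] := Br _ (Bst _ _ sh th).
have UB2 s t : 0 <= s <= h -> 0 <= t <= h -> U (s *: w + (t *: v + a)).
  by move=> sh th; rewrite addrCA; exact: UB1.
have [s [t [sh th E]]] := second_difference h0 UB1 dv dvw.
have [s' [t' [sh' th' E']]] := second_difference h0 UB2 dw dwv.
have {}E : fvw (s *: v + (t *: w + a)) = fwv (s' *: w + (t' *: v + a)).
  apply: (mulfI (lt0r_neq0 h0)); apply: (mulfI (lt0r_neq0 h0)).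
  rewrite -E -E' [h *: w + (h *: v + a)]addrCA; ring.
have W x : 0 < x < h -> 0 <= x <= h by case/andP => *; rewrite !ltW.
have [_ C1 _] := Br _ (Bst _ _ (W _ sh) (W _ th)).
have [_ _] := Br _ (Bst _ _ (W _ th') (W _ sh')).
rewrite [t' *: v + _]addrCA => C2.
rewrite (_ : _ - _ = fvw a - fvw (s *: v + (t *: w + a)) -
   (fwv a - fwv (s' *: w + (t' *: v + a)))); last by rewrite E; ring.
rewrite (le_trans (ler_normB _ _))// [e]splitr lerD// ltW//.
Unshelve. all: by end_near. Qed.

(** The first derivative is negative just after 0, hence so are the increments of
the function from 0. *)
Lemma second_derivative_neg (f df : R -> R) (c : R) :
  (\forall t \near (0 : R), is_derive (t : R^o) (1 : R^o) f (df t)) ->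
  is_derive (0 : R^o) (1 : R^o) df c -> df 0 = 0 -> c < 0 ->
  \forall t \near (0 : R)^'+, f t < f 0.
Proof.
move=> D /is_derive0P dd d0 c0.
have /dd : 0 < - c / 2 by rewrite divr_gt0// oppr_gt0.
move=> /(filterI D) /nbhs_ballP[r /= r0 Br].
near=> h.
have h0 : 0 < h by near: h; exact: nbhs_right_gt.
have hr : h < r by near: h; exact: nbhs_right_lt.
have B t : 0 <= t <= h -> ball 0 r t.
  move=> /andP[t0 th]; rewrite -ball_normE /= sub0r normrN ger0_norm//.
  exact: le_lt_trans th hr.
have [t /B /Br[]//|t /andP[t0 th] E] := @MVT0 f df h h0.
rewrite -subr_lt0 E pmulr_rlt0//.
have /B/Br[_ /= /(le_trans (ler_norm (_ : R)))] : 0 <= t <= h by rewrite !ltW.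
rewrite d0 subr0 (ger0_norm (ltW t0)) -[_ *: _]/(t * c).
have : t * c < 0 by rewrite pmulr_rlt0.
lra.
Unshelve. all: by end_near. Qed.

End MeanValue.

(** * Trace and determinant of an endomorphism read in a coordinate chart *)

Section RestrMx.
Context {R : realType}.

(** The sizes n and m are equal as a consequence, but not definitionally: in the
application n is the dimension of a subspace. *)
Lemma similar_tr_det m n (A : 'M[R]_n) (M : 'M[R]_m) (B : 'M[R]_(n, m)) (C : 'M[R]_(m, n)) :
  B *m C = 1%:M -> C *m B = 1%:M -> A *m B = B *m M ->
  \tr A = \tr M /\ \det A = \det M.
Proof.
move=> BC CB AB.
have EA : A = B *m (M *m C) by rewrite mulmxA -AB -mulmxA BC mulmx1.
split; first by rewrite EA mxtrace_mulC -mulmxA CB mulmx1.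
have Emn : n = m.
  apply/eqP; rewrite eqn_leq -{1}(mxrank1 R n) -{2}(mxrank1 R m) -BC -CB.
  by rewrite !(leq_trans (mxrankM_maxl _ _))// rank_leq_col.
subst n; by rewrite EA !det_mulmx mulrCA -det_mulmx BC det1 mulr1.
Qed.

(** P restricts to a chart of T with inverse I, and M is the matrix of A in that
chart: it is conjugate to the matrix of A in the basis [vbasis T]. *)
Lemma restr_tr_det m (T : {vspace 'rV[R]_3}) (A : 'rV[R]_3 -> 'rV[R]_3)
   (I : 'M[R]_(m, 3)) (P : 'M[R]_(3, m)) (M : 'M[R]_m) :
  I *m P = 1%:M ->
  (forall x, x *m I \in T) -> (forall v, v \in T -> v *m P *m I = v) ->
  (forall v, v \in T -> A v \in T /\ A v *m P = v *m P *m M) ->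
  restr_tr T A = \tr M /\ restr_det T A = \det M.
Proof.
move=> IP TI PI AT.
pose b i := (vbasis T)`_i : 'rV[R]_3.
pose B : 'M[R]_(\dim T, m) := \matrix_i (b i *m P).
pose C : 'M[R]_(m, \dim T) := \matrix_(j, k) coord (vbasis T) k (delta_mx 0 j *m I).
have bT i : (i < \dim T)%N -> b i \in T.
  by move=> iT; rewrite vbasis_mem// mem_nth// size_tuple.
have ET v : v \in T -> \sum_(k < \dim T) coord (vbasis T) k v *: (b k *m P) = v *m P.
  move=> vT; rewrite {2}(coord_vbasis vT) mulmx_suml.
  by apply: eq_bigr => i _; rewrite -scalemxAl.
apply: (@similar_tr_det _ _ _ _ B C).
- apply/matrixP => i k; rewrite mxE.
  have -> : \sum_j B i j * C j k = coord (vbasis T) k (\sum_j B i j *: (delta_mx 0 j *m I)).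
    by rewrite linear_sum; apply: eq_bigr => j _; rewrite linearZ/= [C _ _]mxE.
  have -> : \sum_j B i j *: (delta_mx 0 j *m I) = row i B *m I.
    rewrite [row i B in RHS]row_sum_delta mulmx_suml.
    by apply: eq_bigr => j _; rewrite -scalemxAl [row _ _ _ _]mxE.
  rewrite rowK PI ?bT// coord_free ?mxE 1?eq_sym//.
  exact: basis_free (vbasisP T).
- apply/row_matrixP => j; rewrite row_mul.
  have -> : row j C *m B = \sum_k C j k *: (b k *m P).
    rewrite [row j C]row_sum_delta mulmx_suml.
    by apply: eq_bigr => k _; rewrite -scalemxAl -rowE rowK [row _ _ _ _]mxE.
  under eq_bigr do rewrite mxE.
  by rewrite ET// -mulmxA IP mulmx1 row1.
apply/row_matrixP => i; rewrite !row_mul rowK.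
have [/ET E <-] := AT _ (bT _ (ltn_ord i)).
rewrite -E [row i _]row_sum_delta mulmx_suml.
by apply: eq_bigr => k _; rewrite -scalemxAl -rowE rowK [row _ _ _ _]mxE [restr_mx _ _ _ _]mxE.
Qed.

End RestrMx.

(** * Non-vertical planes and their unit normals *)

Section Vec3.
Context {R : realType}.

Definition vec3 (a b c : R) : 'rV[R]_3 := \row_i [:: a; b; c]`_i.

Lemma vec3E a b c : (vec3 a b c 0 0 = a) * (vec3 a b c 0 1 = b) * (vec3 a b c 0 ord_max = c).
Proof. by rewrite !mxE. Qed.

Lemma ord3P (P : 'I_3 -> Prop) : P 0 -> P 1 -> P ord_max -> forall i, P i.
Proof.
move=> P0 P1 P2; case=> [[|[|[|//]]] i3].
- by rewrite (_ : Ordinal _ = 0)//; exact: val_inj.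
- by rewrite (_ : Ordinal _ = 1)//; exact: val_inj.
- by rewrite (_ : Ordinal _ = ord_max)//; exact: val_inj.
Qed.

Lemma ord2P (P : 'I_2 -> Prop) : P 0 -> P 1 -> forall i, P i.
Proof.
move=> P0 P1; case=> [[|[|//]] i2].
- by rewrite (_ : Ordinal _ = 0)//; exact: val_inj.
- by rewrite (_ : Ordinal _ = 1)//; exact: val_inj.
Qed.

Lemma rV3_eq (u v : 'rV[R]_3) : u 0 0 = v 0 0 -> u 0 1 = v 0 1 ->
  u 0 ord_max = v 0 ord_max -> u = v.
Proof. by move=> *; apply/rowP; apply: ord3P. Qed.

Lemma is_derive_vec3 (V : normedModType R) (f g h : V -> R) a b c (x v : V) :
  is_derive x v f a -> is_derive x v g b -> is_derive x v h c ->
  is_derive x v (fun t => vec3 (f t) (g t) (h t)) (vec3 a b c).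
Proof.
move=> [df fa] [dg gb] [dh hc].
have E i : (fun t => vec3 (f t) (g t) (h t) 0 i) = [:: f; g; h]`_i.
  by elim/ord3P: i; apply/funext => t; rewrite vec3E.
have D : derivable (fun t => vec3 (f t) (g t) (h t)) x v.
  apply/derivable_mxP => i j; rewrite ord1 E.
  by elim/ord3P: j => /=; [exact: df | exact: dg | exact: dh].
split=> //; rewrite derive_mx//; apply/rowP => i; rewrite mxE E.
by elim/ord3P: i; rewrite vec3E.
Qed.

(** The direction of the graph of an affine function of gradient (p, q). *)
Definition graph_plane (p q : R) : {vspace 'rV[R]_3} :=
  <<[:: vec3 1 0 p; vec3 0 1 q]>>%VS.

Lemma mem_graph_plane p q v :
  (v \in graph_plane p q) <-> v 0 ord_max = p * v 0 0 + q * v 0 1.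
Proof.
rewrite /graph_plane span_cons span_seq1; split.
  case/memv_addP => _ /vlineP[a ->] [_ /vlineP[b ->] ->].
  by rewrite !mxE/=; ring.
move=> E; apply/memv_addP; exists (v 0 0 *: vec3 1 0 p); first by rewrite memvZ// memv_line.
exists (v 0 1 *: vec3 0 1 q); first by rewrite memvZ// memv_line.
by apply: rV3_eq; rewrite ?E !mxE/=; ring.
Qed.

(** The Euclidean product for e = 1 and the Lorentzian one for e = - 1; the two
normals and their shape operators are treated together through this sign. *)
Definition sgn_dot (e : R) (u v : 'rV[R]_3) : R :=
  u 0 0 * v 0 0 + u 0 1 * v 0 1 + e * (x3 u * x3 v).

Definition slope_factor (e p q : R) : R := Num.sqrt (1 + e * (p ^+ 2 + q ^+ 2)).

Lemma slope_factorP (e p q : R) : 0 < 1 + e * (p ^+ 2 + q ^+ 2) ->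
  [/\ 0 < slope_factor e p q, slope_factor e p q != 0 &
   slope_factor e p q ^+ 2 = 1 + e * (p ^+ 2 + q ^+ 2)].
Proof.
move=> W2; have W0 : 0 < slope_factor e p q by rewrite sqrtr_gt0.
by split=> //; rewrite ?gt_eqF// sqr_sqrtr// ltW.
Qed.

Definition unit_normal (e p q : R) : 'rV[R]_3 :=
  (slope_factor e p q)^-1 *: vec3 (- (e * p)) (- (e * q)) 1.

Lemma unit_normalP (e p q : R) : e ^+ 2 = 1 -> 0 < 1 + e * (p ^+ 2 + q ^+ 2) ->
  xget 0 [set n : 'rV[R]_3 | [/\ sgn_dot e n n = e,
    forall v, v \in graph_plane p q -> sgn_dot e n v = 0 & 0 < x3 n]] = unit_normal e p q.
Proof.
move=> e1 W2.
have [W0 Wn0 WW] := slope_factorP W2.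
set W := slope_factor e p q in W0 Wn0 WW *.
apply: xget_unique.
  rewrite /unit_normal -/W; split.
  - rewrite /sgn_dot /x3 !mxE/=.
    transitivity (e * (1 + e * (p ^+ 2 + q ^+ 2)) / W ^+ 2); first by field.
    by rewrite -WW mulfK// expf_neq0.
  - move=> v /mem_graph_plane E; rewrite /sgn_dot /x3 E !mxE/=; by ring.
  - by rewrite /x3 !mxE/= mulr1 invr_gt0.
move=> n [nn nT n3].
have n0 : n 0 0 = - (e * p) * x3 n.
  have := nT (vec3 1 0 p); rewrite mem_graph_plane /sgn_dot /x3 !vec3E => /(_ _).
  by move=> H; have {}H := H ltac:(ring); lra.
have n1 : n 0 1 = - (e * q) * x3 n.
  have := nT (vec3 0 1 q); rewrite mem_graph_plane /sgn_dot /x3 !vec3E => /(_ _).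
  by move=> H; have {}H := H ltac:(ring); lra.
have n2 : x3 n = W^-1.
  apply/eqP; rewrite -(@eqrXn2 _ 2)// ?invr_ge0 ?ltW// exprVn.
  rewrite -(mulfK (expf_neq0 2 Wn0) (x3 n ^+ 2)) -[X in _ == X]mul1r.
  apply/eqP; congr (_ / _); rewrite WW.
  have e0 : e != 0 by apply: contra_eq_neq e1 => ->; rewrite expr0n eq_sym oner_eq0.
  apply: (mulfI e0); rewrite mulr1 -[RHS]nn /sgn_dot n0 n1; ring.
apply: rV3_eq; rewrite ?n0 ?n1 -?/(x3 n) n2 !mxE/=; ring.
Qed.

Lemma N_R_graph (Sigma : set 'rV[R]_3) x p q :
  tangent_space Sigma x = graph_plane p q -> N_R Sigma x = unit_normal 1 p q.
Proof.
move=> E; rewrite -unit_normalP; last 2 first.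
- by rewrite expr1n.
- by rewrite mul1r ltr_pwDl// addr_ge0// sqr_ge0.
have -> : sgn_dot 1 = dotR by apply/funext => u; apply/funext => v; rewrite /sgn_dot mul1r.
by rewrite /N_R E.
Qed.

Lemma N_L_graph (Sigma : set 'rV[R]_3) x p q :
  p ^+ 2 + q ^+ 2 < 1 ->
  tangent_space Sigma x = graph_plane p q -> N_L Sigma x = unit_normal (- 1) p q.
Proof.
move=> r1 E; rewrite -unit_normalP; last 2 first.
- by rewrite sqrrN expr1n.
- by rewrite mulN1r subr_gt0.
have -> : sgn_dot (- 1) = dotL by apply/funext => u; apply/funext => v; rewrite /sgn_dot mulN1r.
by rewrite /N_L E.
Qed.

(** The derivative of [unit_normal e p q] when p and q have derivatives a and b,
simplified by means of e^2 = 1. *)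
Definition dunit_normal (e p q a b : R) : 'rV[R]_3 :=
  let W := slope_factor e p q in
  vec3 (- (e * a) / W + (p * a + q * b) * p / W ^+ 3)
       (- (e * b) / W + (p * a + q * b) * q / W ^+ 3)
       (- e * (p * a + q * b) / W ^+ 3).

Lemma is_derive_slope_factorV (e : R) (p q : R^o -> R) a b (t : R^o) :
  0 < 1 + e * (p t ^+ 2 + q t ^+ 2) ->
  is_derive t (1 : R^o) p a -> is_derive t (1 : R^o) q b ->
  is_derive t (1 : R^o) (fun t => (slope_factor e (p t) (q t))^-1 : R)
    (- e * (p t * a + q t * b) / slope_factor e (p t) (q t) ^+ 3).
Proof.
move=> W2 pa qb.
have [W0 Wn0 WW] := slope_factorP W2.
pose u := (fun t => 1 + e * (p t ^+ 2 + q t ^+ 2)) : R^o -> R^o.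
have du : is_derive t (1 : R^o) u (e * (2 * p t * a + 2 * q t * b)).
  have H := is_deriveD (is_derive_cst (1 : R) t (1 : R^o))
    (is_deriveZ e (is_deriveD (is_deriveM pa pa) (is_deriveM qb qb))).
  apply: (is_derive_eq H); rewrite /GRing.scale /=; ring.
have ds := @is_derive1_sqrt R _ W2.
have dw : is_derive t (1 : R^o) (Num.sqrt \o u)
   ((2 * slope_factor e (p t) (q t))^-1 * (e * (2 * p t * a + 2 * q t * b))).
  exact: is_derive1_comp.
apply: (is_derive_eq (@is_deriveV R (Num.sqrt \o u) t _ 1 Wn0 dw)).
rewrite -[(Num.sqrt \o u) t]/(slope_factor e (p t) (q t)).
move: (slope_factor _ _ _) Wn0 => W Wn0; rewrite /GRing.scale /=; field.
exact: Wn0.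
Qed.

Lemma is_derive_unit_normal (e : R) (p q : R^o -> R) a b (t : R^o) :
  e ^+ 2 = 1 -> 0 < 1 + e * (p t ^+ 2 + q t ^+ 2) ->
  is_derive t (1 : R^o) p a -> is_derive t (1 : R^o) q b ->
  is_derive t (1 : R^o) (fun t => unit_normal e (p t) (q t))
    (dunit_normal e (p t) (q t) a b).
Proof.
move=> ee W2 pa qb; have dW := is_derive_slope_factorV W2 pa qb.
have [W0 Wn0 WW] := slope_factorP W2.
have -> : (fun t => unit_normal e (p t) (q t)) = (fun t => vec3
    (- (e * p t) * (slope_factor e (p t) (q t))^-1)
    (- (e * q t) * (slope_factor e (p t) (q t))^-1) ((slope_factor e (p t) (q t))^-1)).
  by apply/funext => x; rewrite /unit_normal; apply: rV3_eq; rewrite !mxE/=; ring.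
have dM (f : R^o -> R) c : is_derive t (1 : R^o) f c ->
    is_derive t (1 : R^o) (fun t => - (e * f t) * (slope_factor e (p t) (q t))^-1 : R)
    (- (e * c) / slope_factor e (p t) (q t) +
     (p t * a + q t * b) * f t / slope_factor e (p t) (q t) ^+ 3).
  move=> df.
  have -> : (fun t => - (e * f t) * (slope_factor e (p t) (q t))^-1 : R) =
    (- (cst e * f)) * (fun t => (slope_factor e (p t) (q t))^-1) by apply/funext.
  apply: is_derive_eq; rewrite !fctE /cst /GRing.scale /=.
  move: (slope_factor _ _ _) Wn0 => W Wn0.
  transitivity (- (e * c) / W + e ^+ 2 * ((p t * a + q t * b) * f t) / W ^+ 3).
    by field.
  by rewrite ee mul1r.
exact: is_derive_vec3.
Qed.

(** A unit normal has constant square, so its derivative is orthogonal to it. *)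
Lemma dunit_normal_graph_plane (e p q a b : R) : e ^+ 2 = 1 ->
  0 < 1 + e * (p ^+ 2 + q ^+ 2) ->
  dunit_normal e p q a b \in graph_plane p q.
Proof.
move=> ee W2; apply/mem_graph_plane; rewrite !vec3E.
have [W0 Wn0 WW] := slope_factorP W2.
set W := slope_factor e p q in W0 Wn0 WW *.
transitivity ((p * a + q * b) * (- e * W ^+ 2 + (p ^+ 2 + q ^+ 2)) / W ^+ 3); last by field.
congr (_ / _); rewrite WW.
transitivity ((p * a + q * b) * (- e  + (1 - e ^+ 2) * (p ^+ 2 + q ^+ 2))); last by ring.
rewrite ee; ring.
Qed.

Lemma sum_ord2 (M : nmodType) (F : 'I_2 -> M) : \sum_i F i = F 0 + F 1.
Proof.
by rewrite !big_ord_recl big_ord0 addr0; congr (_ + F _); exact: val_inj.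
Qed.

Lemma sum_ord3 (M : nmodType) (F : 'I_3 -> M) : \sum_i F i = F 0 + F 1 + F ord_max.
Proof.
rewrite !big_ord_recl big_ord0 addr0 addrA.
by congr (_ + F _ + F _); exact: val_inj.
Qed.

Lemma det_mx2 (M : 'M[R]_2) : \det M = M 0 0 * M 1 1 - M 0 1 * M 1 0.
Proof.
rewrite (expand_det_row _ 0) !big_ord_recl big_ord0 /cofactor !det_mx11 !mxE addr0.
rewrite expr0 expr1 mul1r mulN1r mulrN.
have -> : lift 0 (0 : 'I_1) = 1 :> 'I_2 by exact: val_inj.
by have -> : lift 1 (0 : 'I_1) = 0 :> 'I_2 by exact: val_inj.
Qed.

(** A tangent vector v is determined by its first two coordinates, and in these the
endomorphism A is e S / W corrected by a term of rank one. *)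
Lemma shape_tr_det (A : 'rV[R]_3 -> 'rV[R]_3) (e p q s00 s01 s10 s11 : R) :
  e ^+ 2 = 1 -> 0 < 1 + e * (p ^+ 2 + q ^+ 2) ->
  (forall v, v \in graph_plane p q -> A v = - dunit_normal e p q
     (v 0 0 * s00 + v 0 1 * s10) (v 0 0 * s01 + v 0 1 * s11)) ->
  let W : R := slope_factor e p q in
  restr_tr (graph_plane p q) A =
    e * (s00 + s11) / W -
    (p ^+ 2 * s00 + p * q * (s01 + s10) + q ^+ 2 * s11) / W ^+ 3 /\
  restr_det (graph_plane p q) A = (s00 * s11 - s01 * s10) / W ^+ 4.
Proof.
move=> ee W2 AE.
have [_ + +] := slope_factorP W2.
have := fun v : 'rV[R]_3 => @dunit_normal_graph_plane e p q
  (v 0 0 * s00 + v 0 1 * s10) (v 0 0 * s01 + v 0 1 * s11) ee W2.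
move: AE; rewrite /dunit_normal.
move: (slope_factor e p q) => W AE dT Wn0 WW /=.
pose I := \matrix_(i < 2, j < 3) (if i == 0 then vec3 1 0 p else vec3 0 1 q) 0 j.
pose P := \matrix_(i < 3, j < 2) ((i == j :> nat)%:R : R).
(* (d0, d1) is the product of S and the gradient. *)
pose d0 := p * s00 + q * s01; pose d1 := p * s10 + q * s11.
pose M := \matrix_(i < 2, j < 2) (
  if i == 0 then
    if j == 0 then e * s00 / W - p * d0 / W ^+ 3 else e * s01 / W - q * d0 / W ^+ 3
  else
    if j == 0 then e * s10 / W - p * d1 / W ^+ 3 else e * s11 / W - q * d1 / W ^+ 3) : 'M[R]_2.
have vP v : v *m P = \row_j [:: v 0 0; v 0 1]`_j.
  apply/rowP => j; rewrite !mxE sum_ord3 !mxE.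
  by elim/ord2P: j => /=; rewrite !(mulr1, mulr0, addr0, add0r).
have [| x | v vT | v vT |-> ->] := @restr_tr_det R 2 (graph_plane p q) A I P M.
- apply/row_matrixP => i; rewrite row_mul vP row1; apply/rowP => j.
  by elim/ord2P: i; elim/ord2P: j; rewrite !mxE.
- apply/mem_graph_plane; rewrite !mxE !sum_ord2 !mxE/=; ring.
- have E := (mem_graph_plane _ _ _).1 vT; rewrite vP.
  by apply: rV3_eq; rewrite ?E !mxE sum_ord2 !mxE/=; ring.
- rewrite AE// rpredN dT//; split=> //.
  rewrite mulNmx !vP; apply/rowP => j; rewrite !mxE sum_ord2 !mxE/=.
  by elim/ord2P: j; rewrite /= /d0 /d1; field.
split.
  by rewrite /mxtrace sum_ord2 !mxE/= /d0 /d1; field.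
rewrite det_mx2 !mxE/= /d0 /d1.
transitivity ((e ^+ 2 * W ^+ 2 - e * (p ^+ 2 + q ^+ 2)) * (s00 * s11 - s01 * s10) / W ^+ 4).
  by field.
rewrite ee mul1r WW; congr (_ / _); ring.
Qed.

End Vec3.

(** * Curves in a parametrized surface *)

Section LocalParam.
Context {R : realType} (Sigma : set 'rV[R]_3) (U : set 'rV[R]_2) (V : set 'rV[R]_3)
  (X : 'rV[R]_2 -> 'rV[R]_3) (Y : 'rV[R]_3 -> 'rV[R]_2).
Context (XY : local_param Sigma U V X Y).

Lemma param_differentiable s : U s -> differentiable X s.
Proof. by case: XY => _ smX _ _ _; exact: smooth_on_differentiable smX. Qed.

Lemma param_open : open U. Proof. by case: XY => -[]. Qed.

(** Lines of parameters provide a curve in the surface for every velocity in the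
image of the differential. *)
Lemma curve_of_param s w : U s ->
  curve_in Sigma (X s) ('d X s w) (X \o line s w).
Proof.
move=> Us; have [[oU oV] smX imX _ _] := XY.
exists (line s w @^-1` U); split.
- by split; [exact: open_line | rewrite /preimage/= line0].
- by move=> k; exact: Ck_on_line.
- move=> _ [t Ut <-]; suff : (Sigma `&` V) (X (line s w t)) by case.
  by rewrite -imX; exists (line s w t).
- by rewrite /= line0.
have := is_derive_comp (F := X) (differentiable_line s w 0) (is_derive1_line s w 0).
by rewrite line0 => /(_ (param_differentiable Us))/@derive_val.
Qed.

(** The lift is Y composed with g.  The continuity of Y alone makes it continuous;
it is differentiable by [is_derive_lift], the injective differential of X having a
linear left inverse. *)
Lemma curve_lift s v g : U s -> curve_in Sigma (X s) v g ->
  exists y w, [/\ is_derive (0 : R^o) (1 : R^o) y w, y 0 = s, 'd X s w = v &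
    \forall t \near (0 : R^o), U (y t) /\ X (y t) = g t].
Proof.
move=> Us [I [[oI I0] smg gS g0 gv]].
have [[oU oV] smX imX [YX cY] injX] := XY.
have dX := param_differentiable Us.
have dg : differentiable g 0 by case: (smg 1%N) => + _; exact.
have cg : {for 0, continuous g} by exact: differentiable_continuous.
have isg : is_derive (0 : R^o) (1 : R^o) g v.
  by rewrite -gv; split=> //; exact: diff_derivable.
have [SXs VXs] : (Sigma `&` V) (X s) by rewrite -imX; exists s.
have nSV : \forall t \near (0 : R^o), (Sigma `&` V) (g t).
  near=> t; split; first by apply: gS; exists t => //; near: t; exact: open_nbhs_nbhs.
  near: t; apply: cg; rewrite g0; exact: open_nbhs_nbhs.
have nU : \forall t \near (0 : R^o), U (Y (g t)) /\ X (Y (g t)) = g t.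
  near=> t; have : (X @` U) (g t) by rewrite imX; near: t.
  by case=> u Uu Eu; rewrite -Eu YX.
have cYg : {for 0, continuous (Y \o g)}.
  move/subspace_continuousP : cY => /(_ (X s) (conj SXs VXs)) cYs.
  rewrite /prop_for /continuous_at /= g0.
  apply: cvg_comp cYs => A /=.
  rewrite /within/= => nA.
  have {}nA : \forall t \near (0 : R^o), (Sigma `&` V) (g t) -> A (g t).
    by have := cg [set x | (Sigma `&` V) x -> A x]; rewrite g0 => /(_ nA).
  by apply: filterS2 nA nSV => t /[apply].
have Jfree : row_free ('J X s).
  apply: inj_row_free => w w0; apply: (injX _ Us).
  by rewrite linear0 -[LHS]mul_rV_lin1.
pose L := mulmxr (pinvmx ('J X s)) : {linear 'rV[R]_3 -> 'rV[R]_2}.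
have LK w : L ('d X s w) = w.
  by rewrite /L/= -[X in X *m _]mul_rV_lin1 mulmxKp.
have Y0 : (Y \o g) 0 = s by rewrite /= g0 YX.
have dy : is_derive (0 : R^o) (1 : R^o) (Y \o g) (L v).
  apply: (is_derive_lift dX _ LK cYg Y0 _ isg); first exact: linear_rV_continuous.
  by apply: filterS nU => t [].
exists (Y \o g), (L v); split=> //.
have dy' : differentiable (Y \o g) 0 by apply/derivable1_diffP; case: dy.
have := @is_derive_comp _ _ _ _ (Y \o g) X 0 1 (L v) dy' dy.
rewrite Y0 => /(_ dX) H.
have {}H : is_derive (0 : R^o) (1 : R^o) g ('d X s (L v)).
  by apply: near_eq_is_derive H; apply: filterS nU => t [].
by rewrite -[RHS](@derive_val _ _ _ _ _ _ _ isg) (@derive_val _ _ _ _ _ _ _ H).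
Unshelve. all: by end_near. Qed.

Lemma tangent_space_param s (T : {vspace 'rV[R]_3}) : U s ->
  (forall v, v \in T <-> exists w, 'd X s w = v) -> tangent_space Sigma (X s) = T.
Proof.
move=> Us TE.
have TP v : v \in T <-> exists g, curve_in Sigma (X s) v g.
  rewrite TE; split=> [[w <-]|[g /(curve_lift Us)[y [w [_ _ <- _]]]]]; last by exists w.
  by exists (X \o line s w); exact: curve_of_param.
apply: xget_unique => // T' /= T'P; apply/vspaceP => v.
by apply/idP/idP; [move/T'P/TP|move/TP/T'P].
Qed.

End LocalParam.

(** * Slopes of the tangent plane and their derivatives *)

Section ContinuousAt.
Context {R : realType} {T : topologicalType}.
Implicit Types (f g : T -> R) (x : T).

Lemma continuous_atD f g x : {for x, continuous f} -> {for x, continuous g} ->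
  {for x, continuous (fun y => f y + g y)}.
Proof. exact: (@continuousD R R^o). Qed.

Lemma continuous_atB f g x : {for x, continuous f} -> {for x, continuous g} ->
  {for x, continuous (fun y => f y - g y)}.
Proof. exact: (@continuousB R R^o). Qed.

Lemma continuous_atM f g x : {for x, continuous f} -> {for x, continuous g} ->
  {for x, continuous (fun y => f y * g y)}.
Proof. exact: continuousM. Qed.

End ContinuousAt.

Definition ebase {R : realType} (i : 'I_2) : 'rV[R]_2 := delta_mx 0 i.

Definition partial {R : realType} (X : 'rV[R]_2 -> 'rV[R]_3) i k (s : 'rV[R]_2) : R :=
  'D_(ebase i) X s 0 k.
Definition partial2 {R : realType} (X : 'rV[R]_2 -> 'rV[R]_3) i j k (s : 'rV[R]_2) : R :=
  'D_(ebase i) ('D_(ebase j) X) s 0 k.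

Section Coordinates.
Context {R : realType}.

Lemma is_derive_coord (V : normedModType R) n (F : V -> 'rV[R]_n) (x v : V) d k :
  is_derive x v F d -> is_derive x v (fun x => F x 0 k) (d 0 k).
Proof.
move=> [dF <-]; split; first exact: (derivable_mxP _ _ _).1.
by rewrite derive_mx// mxE.
Qed.

Lemma differentiable_coord_comp (V : normedModType R) n (F : V -> 'rV[R]_n) (x : V) k :
  differentiable F x -> differentiable (fun x => F x 0 k) x.
Proof.
move=> dF.
exact: (@differentiable_comp _ _ _ _ F (fun M : 'rV[R]_n => M 0 k) x dF
  (differentiable_coord _ _ _)).
Qed.

Lemma diff_ebase (F : 'rV[R]_2 -> R) s w :
  'd F s w = w 0 0 * 'd F s (ebase 0) + w 0 1 * 'd F s (ebase 1).
Proof. by rewrite {1}[w]row_sum_delta linear_sum sum_ord2 !linearZ. Qed.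

Section Smooth.
Context (U : set 'rV[R]_2) (X : 'rV[R]_2 -> 'rV[R]_3).
Context (oU : open U) (smX : smooth_on U X).

Lemma diff_partial s w k : U s ->
  'd X s w 0 k = w 0 0 * partial X 0 k s + w 0 1 * partial X 1 k s.
Proof.
move=> Us; have dX := smooth_on_differentiable smX Us.
by rewrite /partial !deriveE// {1}[w]row_sum_delta linear_sum sum_ord2 !linearZ/= !mxE.
Qed.

Lemma is_derive_coord_partial s i k : U s ->
  is_derive s (ebase i) (fun s => X s 0 k) (partial X i k s).
Proof.
move=> Us; apply: is_derive_coord; apply: derivableP; apply: diff_derivable.
exact: smooth_on_differentiable smX Us.
Qed.

Lemma is_derive_partial s i j k : U s ->
  is_derive s (ebase i) (partial X j k) (partial2 X i j k s).
Proof.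
move=> Us; apply: is_derive_coord; apply: derivableP; apply: diff_derivable.
exact: smooth_on_differentiable (smooth_on_derive _ smX) Us.
Qed.

Lemma differentiable_partial s j k : U s -> differentiable (partial X j k) s.
Proof.
move=> Us; apply: differentiable_coord_comp.
exact: smooth_on_differentiable (smooth_on_derive _ smX) Us.
Qed.

Lemma continuous_partial s j k : U s -> {for s, continuous (partial X j k)}.
Proof. by move=> Us; apply: differentiable_continuous; exact: differentiable_partial. Qed.

Lemma continuous_partial2 s i j k : U s -> {for s, continuous (partial2 X i j k)}.
Proof.
move=> Us; apply: differentiable_continuous.
apply: differentiable_coord_comp.
exact: smooth_on_differentiable (smooth_on_derive _ (smooth_on_derive _ smX)) Us.
Qed.

Lemma partial2C s i j k : U s -> partial2 X i j k s = partial2 X j i k s.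
Proof.
move=> Us.
apply: (@mixed_derivatives_eq _ _ U (fun s => X s 0 k) (partial X j k) (partial X i k)
   _ _ (ebase j) (ebase i)) => //.
- by move=> x; exact: is_derive_coord_partial.
- by move=> x; exact: is_derive_coord_partial.
- by move=> x; exact: is_derive_partial.
- by move=> x; exact: is_derive_partial.
- exact: continuous_partial2.
- exact: continuous_partial2.
Qed.

End Smooth.

(** The Jacobian determinant of the projection of X to the plane x3 = 0. *)
Definition jac (X : 'rV[R]_2 -> 'rV[R]_3) s : R :=
  partial X 0 0 s * partial X 1 1 s - partial X 0 1 s * partial X 1 0 s.

(** [slope0] and [slope1] solve, by Cramer's rule, the two linear equations of
[partial_slope]. *)
Definition slope0 (X : 'rV[R]_2 -> 'rV[R]_3) s : R :=
  (partial X 0 ord_max s * partial X 1 1 s - partial X 1 ord_max s * partial X 0 1 s) / jac X s.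

Definition slope1 (X : 'rV[R]_2 -> 'rV[R]_3) s : R :=
  (partial X 0 0 s * partial X 1 ord_max s - partial X 1 0 s * partial X 0 ord_max s) / jac X s.

(** The second fundamental form of X with respect to the normal (-p, -q, 1), which
has third coordinate 1 instead of unit length. *)
Definition second_form (X : 'rV[R]_2 -> 'rV[R]_3) i j s : R :=
  partial2 X i j ord_max s - slope0 X s * partial2 X i j 0 s - slope1 X s * partial2 X i j 1 s.

Lemma partial_slope (X : 'rV[R]_2 -> 'rV[R]_3) s i : jac X s != 0 ->
  partial X i ord_max s = slope0 X s * partial X i 0 s + slope1 X s * partial X i 1 s.
Proof.
move=> d0; rewrite -[LHS](mulfK d0) [X in _ * X / _]/jac /slope0 /slope1.
move: (jac X s) d0 => d d0.
elim/ord2P: i; move: (partial X 0 0 s) (partial X 0 1 s) (partial X 0 ord_max s) => a b c;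
  move: (partial X 1 0 s) (partial X 1 1 s) (partial X 1 ord_max s) => a' b' c'; by field.
Qed.

Section Immersion.
Context (U : set 'rV[R]_2) (X : 'rV[R]_2 -> 'rV[R]_3).
Context (oU : open U) (smX : smooth_on U X) (jac0 : forall s, U s -> jac X s != 0).

Lemma continuous_jac s : U s -> {for s, continuous (jac X)}.
Proof.
move=> Us; have c j k : {for s, continuous (partial X j k)} by exact: continuous_partial Us.
by rewrite /jac; apply: continuous_atB; apply: continuous_atM; exact: c.
Qed.

Lemma continuous_slope0 s : U s -> {for s, continuous (slope0 X)}.
Proof.
move=> Us; have c j k : {for s, continuous (partial X j k)} by exact: continuous_partial Us.
rewrite /slope0; apply: continuous_atM.
  by apply: continuous_atB; apply: continuous_atM; exact: c.
by apply: continuousV; [exact: jac0 | exact: continuous_jac].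
Qed.

Lemma continuous_slope1 s : U s -> {for s, continuous (slope1 X)}.
Proof.
move=> Us; have c j k : {for s, continuous (partial X j k)} by exact: continuous_partial Us.
rewrite /slope1; apply: continuous_atM.
  by apply: continuous_atB; apply: continuous_atM; exact: c.
by apply: continuousV; [exact: jac0 | exact: continuous_jac].
Qed.

Lemma continuous_second_form s i j : U s -> {for s, continuous (second_form X i j)}.
Proof.
move=> Us; have c k : {for s, continuous (partial2 X i j k)} by exact: continuous_partial2 Us.
have c0 := continuous_slope0 Us; have c1 := continuous_slope1 Us.
rewrite /second_form; apply: continuous_atB; last exact: continuous_atM.
by apply: continuous_atB; [exact: c | exact: continuous_atM].
Qed.

Lemma differentiable_slope s : U s ->
  differentiable (slope0 X) s /\ differentiable (slope1 X) s.
Proof.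
move=> Us; have c j k := differentiable_partial smX j k Us.
have dj : differentiable (jac X) s.
  by apply: differentiableB; apply: differentiableM; exact: c.
have djV : differentiable (fun s => (jac X s)^-1) s by apply: differentiableV => //; exact: jac0.
by split; apply: differentiableM => //; apply: differentiableB; apply: differentiableM; exact: c.
Qed.

(** Differentiating [partial_slope]: the terms containing second derivatives of X are
those subtracted in the definition of [second_form].

The derivatives of the slopes are arbitrary reals n0 and n1 here, so that the final
identity is between polynomials in plain variables. *)
Lemma second_form_slope_derive s i j n0 n1 : U s ->
  is_derive s (ebase i) (slope0 X) n0 -> is_derive s (ebase i) (slope1 X) n1 ->
  second_form X i j s = n0 * partial X j 0 s + n1 * partial X j 1 s.
Proof.
move=> Us i0 i1; have c k := is_derive_partial smX i j k Us.
have : is_derive s (ebase i) (slope0 X * partial X j 0 + slope1 X * partial X j 1)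
    (partial2 X i j ord_max s).
  apply: near_eq_is_derive (c ord_max).
  by apply: filterS (open_nbhs_nbhs (conj oU Us)) => x Ux; rewrite partial_slope// jac0.
move=> /@derive_val; rewrite /second_form => <-.
have -> := @derive_val _ _ _ _ _ _ _ (is_deriveD (is_deriveM i0 (c 0)) (is_deriveM i1 (c 1))).
rewrite /GRing.scale /=; ring.
Qed.

Lemma second_form_slope s i j : U s ->
  second_form X i j s = 'd (slope0 X) s (ebase i) * partial X j 0 s +
                        'd (slope1 X) s (ebase i) * partial X j 1 s.
Proof.
move=> Us; have [d0 d1] := differentiable_slope Us.
by apply: second_form_slope_derive => //; exact: differentiable_is_derive.
Qed.

Lemma second_formC s i j : U s -> second_form X i j s = second_form X j i s.
Proof.
move=> Us; have E k : partial2 X i j k s = partial2 X j i k s by apply: (partial2C oU smX).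
by rewrite /second_form !E.
Qed.

End Immersion.

End Coordinates.

(** * The Hessian of the height function *)

(** If h_ij = p_i J_j0 + q_i J_j1 for the matrix J with rows (a, b) and (c, d), and
v is the first row of the inverse of J, then the contraction of h with u and v
involves only p; [contract_inv1] is the case of the second row. *)
Lemma contract_inv0 (R : comRingType)
    (u0 u1 v0 v1 a b c d p0 p1 q0 q1 : R) :
  v0 * a + v1 * c = 1 -> v0 * b + v1 * d = 0 ->
  u0 * v0 * (p0 * a + q0 * b) + u0 * v1 * (p0 * c + q0 * d) +
  (u1 * v0 * (p1 * a + q1 * b) + u1 * v1 * (p1 * c + q1 * d)) =
  u0 * p0 + u1 * p1.
Proof.
move=> E1 E0; transitivity
  ((u0 * p0 + u1 * p1) * (v0 * a + v1 * c) + (u0 * q0 + u1 * q1) * (v0 * b + v1 * d)).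
  ring.
by rewrite E1 E0 mulr1 mulr0 addr0.
Qed.

Lemma contract_inv1 (R : comRingType)
    (u0 u1 v0 v1 a b c d p0 p1 q0 q1 : R) :
  v0 * a + v1 * c = 0 -> v0 * b + v1 * d = 1 ->
  u0 * v0 * (p0 * a + q0 * b) + u0 * v1 * (p0 * c + q0 * d) +
  (u1 * v0 * (p1 * a + q1 * b) + u1 * v1 * (p1 * c + q1 * d)) =
  u0 * q0 + u1 * q1.
Proof.
move=> E1 E0; transitivity
  ((u0 * p0 + u1 * p1) * (v0 * a + v1 * c) + (u0 * q0 + u1 * q1) * (v0 * b + v1 * d)).
  ring.
by rewrite E1 E0 mulr1 mulr0 add0r.
Qed.

Section Hess.
Context {R : realType} (X : 'rV[R]_2 -> 'rV[R]_3).
Implicit Types s : 'rV[R]_2.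

(** The inverse of the Jacobian matrix: row a holds the parameter velocity that moves
the projection to x3 = 0 along the axis a. *)
Definition inv_jac (a i : 'I_2) s : R :=
  (if a == 0 then if i == 0 then partial X 1 1 s else - partial X 0 1 s
   else if i == 0 then - partial X 1 0 s else partial X 0 0 s) / jac X s.

(** In the coordinates x_0, x_1 of the plane x3 = 0, the surface is locally the graph of
a function whose second derivatives are these numbers. *)
Definition graph_hess (a b : 'I_2) s : R :=
  inv_jac a 0 s * inv_jac b 0 s * second_form X 0 0 s +
  inv_jac a 0 s * inv_jac b 1 s * second_form X 0 1 s +
  (inv_jac a 1 s * inv_jac b 0 s * second_form X 1 0 s +
   inv_jac a 1 s * inv_jac b 1 s * second_form X 1 1 s).

Definition plane_lift s (x y : R) : 'rV[R]_2 :=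
  \row_i (x * inv_jac 0 i s + y * inv_jac 1 i s).

Context (U : set 'rV[R]_2).
Context (oU : open U) (smX : smooth_on U X) (jac0 : forall s, U s -> jac X s != 0).

Lemma continuous_inv_jac a i s : U s -> {for s, continuous (inv_jac a i)}.
Proof.
move=> Us; have c j k : {for s, continuous (partial X j k)} by exact: continuous_partial Us.
have cN j k : {for s, continuous (fun s => - partial X j k s)}.
  exact: (@continuousN _ R^o _ _ _ (c j k)).
rewrite /inv_jac; apply: continuous_atM.
  by elim/ord2P: a; elim/ord2P: i => /=.
by apply: continuousV; [exact: jac0 | exact: continuous_jac Us].
Qed.

Lemma continuous_graph_hess a b s : U s -> {for s, continuous (graph_hess a b)}.
Proof.
move=> Us; have cf i j : {for s, continuous (second_form X i j)}.
  by exact: continuous_second_form Us.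
have ci a' i : {for s, continuous (inv_jac a' i)} by exact: continuous_inv_jac.
have ct i j : {for s, continuous (fun s =>
    inv_jac a i s * inv_jac b j s * second_form X i j s)}.
  by apply: continuous_atM; first exact: continuous_atM.
by rewrite /graph_hess; apply: continuous_atD; apply: continuous_atD; exact: ct.
Qed.

Lemma graph_hessC a b s : U s -> graph_hess a b s = graph_hess b a s.
Proof.
move=> Us; rewrite /graph_hess (second_formC oU smX 1 0 Us).
move: (inv_jac a 0 s) (inv_jac a 1 s) (inv_jac b 0 s) (inv_jac b 1 s) => a0 a1 b0 b1.
move: (second_form X 0 0 s) (second_form X 0 1 s) (second_form X 1 1 s) => f g h.
ring.
Qed.

Lemma diff_plane_lift s x y : U s -> let v := 'd X s (plane_lift s x y) in
  v 0 0 = x /\ v 0 1 = y.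
Proof.
move=> Us /=; have := jac0 Us; rewrite !(diff_partial smX _ _ Us) !mxE /inv_jac /= /jac.
move: (partial X 0 0 s) (partial X 0 1 s) (partial X 1 0 s) (partial X 1 1 s) => a b c d0 j0.
by split; field.
Qed.

Lemma second_form_plane_lift s x y : U s ->
  let w := plane_lift s x y in
  w 0 0 ^+ 2 * second_form X 0 0 s + 2 * w 0 0 * w 0 1 * second_form X 0 1 s +
    w 0 1 ^+ 2 * second_form X 1 1 s =
  x ^+ 2 * graph_hess 0 0 s + 2 * x * y * graph_hess 0 1 s + y ^+ 2 * graph_hess 1 1 s.
Proof.
move=> Us; rewrite /= /graph_hess !mxE (second_formC oU smX 1 0 Us).
move: (inv_jac 0 0 s) (inv_jac 0 1 s) (inv_jac 1 0 s) (inv_jac 1 1 s) => a b c d0.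
move: (second_form X 0 0 s) (second_form X 0 1 s) (second_form X 1 1 s) => f g h.
ring.
Qed.

Lemma inv_jac_mul s : U s ->
  (inv_jac 0 0 s * partial X 0 0 s + inv_jac 0 1 s * partial X 1 0 s = 1) *
  (inv_jac 0 0 s * partial X 0 1 s + inv_jac 0 1 s * partial X 1 1 s = 0) *
  (inv_jac 1 0 s * partial X 0 0 s + inv_jac 1 1 s * partial X 1 0 s = 0) *
  (inv_jac 1 0 s * partial X 0 1 s + inv_jac 1 1 s * partial X 1 1 s = 1).
Proof.
move=> Us; have := jac0 Us; rewrite /inv_jac /= /jac.
move: (partial X 0 0 s) (partial X 0 1 s) (partial X 1 0 s) (partial X 1 1 s) => a b c d j0.
by split; [split; [split|]|]; field.
Qed.

(** The Hessian is the derivative of the gradient. *)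
Lemma graph_hess_slope (a : 'I_2) s : U s ->
  graph_hess a 0 s = inv_jac a 0 s * 'd (slope0 X) s (ebase 0) +
                     inv_jac a 1 s * 'd (slope0 X) s (ebase 1) /\
  graph_hess a 1 s = inv_jac a 0 s * 'd (slope1 X) s (ebase 0) +
                     inv_jac a 1 s * 'd (slope1 X) s (ebase 1).
Proof.
move=> Us; have E i j := second_form_slope oU smX jac0 i j Us.
have I := inv_jac_mul Us.
split; rewrite /graph_hess (E 0 0) (E 0 1) (E 1 0) (E 1 1).
  by apply: contract_inv0; rewrite I.
by apply: contract_inv1; rewrite I.
Qed.

Lemma diff_slope_plane_lift s x y : U s -> let w := plane_lift s x y in
  'd (slope0 X) s w = x * graph_hess 0 0 s + y * graph_hess 1 0 s /\
  'd (slope1 X) s w = x * graph_hess 0 1 s + y * graph_hess 1 1 s.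
Proof.
move=> Us w; have [-> ->] := graph_hess_slope 0 Us; have [-> ->] := graph_hess_slope 1 Us.
have w0 : w 0 0 = x * inv_jac 0 0 s + y * inv_jac 1 0 s by rewrite mxE.
have w1 : w 0 1 = x * inv_jac 0 1 s + y * inv_jac 1 1 s by rewrite mxE.
have regroup (a b c d p0 p1 : R) : (x * a + y * b) * p0 + (x * c + y * d) * p1 =
    x * (a * p0 + c * p1) + y * (b * p0 + d * p1) by ring.
by split; rewrite diff_ebase w0 w1; apply: regroup.
Qed.

End Hess.

(** * Shape operators of a spacelike surface *)

Section Shape.
Context {R : realType} (Sigma : set 'rV[R]_3) (U : set 'rV[R]_2) (V : set 'rV[R]_3)
  (X : 'rV[R]_2 -> 'rV[R]_3) (Y : 'rV[R]_3 -> 'rV[R]_2).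
Context (spS : spacelike_surface Sigma) (XY : local_param Sigma U V X Y).

Let oU : open U := param_open XY.
Let smX : smooth_on U X. Proof. by case: XY. Qed.

Lemma param_in s : U s -> Sigma (X s).
Proof.
case: XY => _ _ imX _ _ Us; suff : (Sigma `&` V) (X s) by case.
by rewrite -imX; exists s.
Qed.

Lemma spacelike_diff s (w : 'rV[R]_2) : U s -> w != 0 -> 0 < dotL ('d X s w) ('d X s w).
Proof.
move=> Us w0; have [_ sp] := spS.
pose T : {vspace 'rV[R]_3} := <<[:: 'd X s (ebase 0%R); 'd X s (ebase 1%R)]>>%VS.
have TE v : v \in T <-> exists w, 'd X s w = v.
  rewrite /T span_cons span_seq1; split.
    case/memv_addP => _ /vlineP[a ->] [_ /vlineP[b ->] ->].
    by exists (a *: ebase 0 + b *: ebase 1); rewrite linearD !linearZ.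
  move=> [u <-]; rewrite [u]row_sum_delta sum_ord2 linearD !linearZ.
  by rewrite memv_add// memvZ// memv_line.
apply: (sp (X s)); first exact: param_in.
  by rewrite (tangent_space_param XY Us TE); apply/TE; exists w.
apply: contra_neq w0 => d0; have [_ _ _ _ inj] := XY.
by apply: (inj s Us); rewrite linear0.
Qed.

(** A tangent vector that projects to 0 on the plane x3 = 0 is vertical, and a
vertical vector is not spacelike. *)
Lemma spacelike_jac s : U s -> jac X s != 0.
Proof.
move=> Us; apply/eqP => j0.
pose A : 'M[R]_2 := \matrix_(i, k) (if k == 0 then partial X i 0 s else partial X i 1 s).
have /det0P[w w0 wA] : \det A == 0 by rewrite det_mx2 !mxE/= -j0.
have := spacelike_diff Us w0.
rewrite /dotL !(diff_partial smX _ _ Us).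
have /rowP E := wA.
have := E 0; rewrite !mxE sum_ord2 !mxE /= => ->.
have := E 1; rewrite !mxE sum_ord2 !mxE /= => ->.
by rewrite !mul0r !add0r oppr_gt0 ltNge -expr2 sqr_ge0.
Qed.

Let jac0 := spacelike_jac.

Lemma diff_graph_plane s w : U s -> 'd X s w \in graph_plane (slope0 X s) (slope1 X s).
Proof.
move=> Us; apply/mem_graph_plane; rewrite !(diff_partial smX _ _ Us) !partial_slope ?jac0//.
move: (partial X 0 0 s) (partial X 0 1 s) (partial X 1 0 s) (partial X 1 1 s) => a b c d.
move: (slope0 X s) (slope1 X s) => p q; ring.
Qed.

Lemma diff_plane_lift_id s v : U s -> v \in graph_plane (slope0 X s) (slope1 X s) ->
  'd X s (plane_lift X s (v 0 0) (v 0 1)) = v.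
Proof.
move=> Us /mem_graph_plane vE.
have [E0 E1] := diff_plane_lift smX jac0 (v 0 0) (v 0 1) Us.
apply: rV3_eq => //.
by rewrite ((mem_graph_plane _ _ _).1 (diff_graph_plane _ Us)) E0 E1 vE.
Qed.

Lemma tangent_space_graph s : U s ->
  tangent_space Sigma (X s) = graph_plane (slope0 X s) (slope1 X s).
Proof.
move=> Us; apply: (tangent_space_param XY Us) => v; split=> [vT|[w <-]].
  by exists (plane_lift X s (v 0 0) (v 0 1)); exact: diff_plane_lift_id.
exact: diff_graph_plane.
Qed.

(** The tangent vector (p, q, r2) lies in the direction of steepest ascent; its
Lorentzian square is r2 (1 - r2). *)
Lemma slope_lt1 s : U s -> slope0 X s ^+ 2 + slope1 X s ^+ 2 < 1.
Proof.
move=> Us; have [_ sp] := spS.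
have := sp (X s) (vec3 (slope0 X s) (slope1 X s) (slope0 X s ^+ 2 + slope1 X s ^+ 2)).
move=> /(_ (param_in Us)); rewrite tangent_space_graph//.
move: (slope0 X s) (slope1 X s) => p q.
have [->|r0] := eqVneq (p ^+ 2 + q ^+ 2) 0; first by move=> _; exact: ltr01.
have r1 : 0 < p ^+ 2 + q ^+ 2 by rewrite lt0r r0 addr_ge0// sqr_ge0.
move=> H; have : 0 < (p ^+ 2 + q ^+ 2) * (1 - (p ^+ 2 + q ^+ 2)).
  have := H _ _; rewrite /dotL /x3 !vec3E => H'.
  have -> : (p ^+ 2 + q ^+ 2) * (1 - (p ^+ 2 + q ^+ 2)) =
     p * p + q * q - (p ^+ 2 + q ^+ 2) * (p ^+ 2 + q ^+ 2) by ring.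
  apply: H'; first by apply/mem_graph_plane; rewrite !vec3E; ring.
  apply: contra_neq r0 => /rowP/(_ ord_max); by rewrite !vec3E mxE.
by rewrite pmulr_rgt0// subr_gt0.
Qed.

(** By [curve_lift], along any curve in the surface with velocity 'd X s w the field N
has the derivative it has along the line of parameters of velocity w. *)
Lemma nabla_normal (N : 'rV[R]_3 -> 'rV[R]_3) e s w : e ^+ 2 = 1 -> U s ->
  0 < 1 + e * (slope0 X s ^+ 2 + slope1 X s ^+ 2) ->
  (forall u, U u -> N (X u) = unit_normal e (slope0 X u) (slope1 X u)) ->
  nabla Sigma N (X s) ('d X s w) =
  dunit_normal e (slope0 X s) (slope1 X s) ('d (slope0 X) s w) ('d (slope1 X) s w).
Proof.
move=> ee Us W2 NE.
have [ds0 ds1] := differentiable_slope smX jac0 Us.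
have key g : curve_in Sigma (X s) ('d X s w) g -> is_derive (0 : R^o) (1 : R^o) (N \o g)
    (dunit_normal e (slope0 X s) (slope1 X s) ('d (slope0 X) s w) ('d (slope1 X) s w)).
  move=> /(curve_lift XY Us)[y [w' [dy y0 Ew yg]]].
  have {}Ew : w' = w by have [_ _ _ _ inj] := XY; exact: (inj s Us).
  subst w'.
  have dy' : differentiable y 0 by apply/derivable1_diffP; case: dy.
  have d0 := is_derive_comp dy' dy; rewrite y0 in d0.
  have D0 := d0 _ _ ds0; have D1 := d0 _ _ ds1.
  have := @is_derive_unit_normal R e (slope0 X \o y) (slope1 X \o y) _ _ 0 ee.
  rewrite /= y0 => /(_ _ _ W2 D0 D1).
  apply: near_eq_is_derive; apply: filterS yg => t [Uy E].
  by rewrite /= -E NE.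
apply: xget_unique.
  have cw := curve_of_param XY w Us.
  by exists (X \o line s w); split; [exact: cw|exact: key].
move=> n [g [/key gk ng]].
by rewrite -(@derive_val _ _ _ _ _ _ _ gk) -[LHS](@derive_val _ _ _ _ _ _ _ ng).
Qed.

Lemma shape_operator (N : 'rV[R]_3 -> 'rV[R]_3) e s : e ^+ 2 = 1 -> U s ->
  0 < 1 + e * (slope0 X s ^+ 2 + slope1 X s ^+ 2) ->
  (forall u, U u -> N (X u) = unit_normal e (slope0 X u) (slope1 X u)) ->
  let A v := - nabla Sigma N (X s) v in
  let W : R := slope_factor e (slope0 X s) (slope1 X s) in
  restr_tr (tangent_space Sigma (X s)) A =
    e * (graph_hess X 0 0 s + graph_hess X 1 1 s) / W -
    (slope0 X s ^+ 2 * graph_hess X 0 0 s +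
       slope0 X s * slope1 X s * (graph_hess X 0 1 s + graph_hess X 1 0 s) +
       slope1 X s ^+ 2 * graph_hess X 1 1 s) / W ^+ 3 /\
  restr_det (tangent_space Sigma (X s)) A =
    (graph_hess X 0 0 s * graph_hess X 1 1 s - graph_hess X 0 1 s * graph_hess X 1 0 s) / W ^+ 4.
Proof.
move=> ee Us W2 NE A W; rewrite tangent_space_graph//; apply: shape_tr_det => // v vT.
have Ev := diff_plane_lift_id Us vT.
rewrite /A -{1}Ev (nabla_normal _ ee Us W2 NE).
have [E0 E1] := diff_slope_plane_lift oU smX jac0 (v 0 0) (v 0 1) Us.
exact: (congr2 (fun a b => - dunit_normal e _ _ a b) E0 E1).
Qed.

End Shape.

(** * The inequality for the Hessian *)

Section Algebra.
Context {R : realType}.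
Implicit Types (p q s t u a b : R).

(** Here S has diagonal entries s, u and off-diagonal entries t, and a, b are the two
square roots.  Clearing denominators makes the factor a - b appear, which vanishes
to the second order with the gradient. *)
Lemma mean_curvature_eq p q s t u a b : a != 0 -> b != 0 ->
  let D := s + u in let Q := p ^+ 2 * s + p * q * (t + t) + q ^+ 2 * u in
  D / a - Q / a ^+ 3 = D / b + Q / b ^+ 3 ->
  Q * (a ^+ 3 + b ^+ 3) = - (D * (a ^+ 2 * b ^+ 2) * (a - b)).
Proof.
move=> a0 b0 D Q.
move: D Q => D Q E.
have : (D / a - Q / a ^+ 3) * (a ^+ 3 * b ^+ 3) =
       (D / b + Q / b ^+ 3) * (a ^+ 3 * b ^+ 3) by rewrite E.
have -> : (D / a - Q / a ^+ 3) * (a ^+ 3 * b ^+ 3) =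
          D * a ^+ 2 * b ^+ 3 - Q * b ^+ 3 by field; rewrite a0.
have -> : (D / b + Q / b ^+ 3) * (a ^+ 3 * b ^+ 3) =
          D * a ^+ 3 * b ^+ 2 + Q * a ^+ 3 by field; rewrite b0.
move=> E'; have -> : Q * (a ^+ 3 + b ^+ 3) = Q * a ^+ 3 + Q * b ^+ 3 by ring.
have -> : Q * a ^+ 3 = D * a ^+ 2 * b ^+ 3 - Q * b ^+ 3 - D * a ^+ 3 * b ^+ 2.
  by rewrite E'; ring.
ring.
Qed.

(** In an orthonormal frame along the gradient, S has diagonal entries - m D and
(1 + m) D, so its determinant is - m (1 + m) D^2 minus the square of the other
entry.  Replacing m by its lower bound b^2 / (2 a^2) removes the square roots, which
leaves an inequality that is polynomial in p, q and S. *)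
Lemma hessian_det_le p q s t u a b : 0 < a -> 0 < b ->
  a ^+ 2 = 1 + (p ^+ 2 + q ^+ 2) -> b ^+ 2 = 1 - (p ^+ 2 + q ^+ 2) ->
  let D := s + u in let Q := p ^+ 2 * s + p * q * (t + t) + q ^+ 2 * u in
  Q * (a ^+ 3 + b ^+ 3) = - (D * (a ^+ 2 * b ^+ 2) * (a - b)) ->
  p ^+ 2 + q ^+ 2 != 0 ->
  2 * a ^+ 2 * (s * u - t ^+ 2) + b ^+ 2 * D ^+ 2 <= 0.
Proof.
move=> a0 b0 a2 b2 D Q EQ r0.
set r := p ^+ 2 + q ^+ 2 in a2 b2 r0.
have r_gt0 : 0 < r by rewrite lt0r r0 addr_ge0// sqr_ge0.
have ab0 : 0 < a + b by rewrite addr_gt0.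
have c0 : 0 < a ^+ 3 + b ^+ 3 by rewrite addr_gt0// exprn_gt0.
have ba : b <= a by rewrite -(@ler_pXn2r _ 2)// ?nnegrE ?ltW// a2 b2; lra.
pose m := 2 * a ^+ 2 * b ^+ 2 / ((a + b) * (a ^+ 3 + b ^+ 3)).
have m0 : 0 < m by rewrite divr_gt0// !mulr_gt0// ?exprn_gt0.
(* Here r = (a^2 - b^2) / 2 is used, to divide by a + b. *)
have Qm : Q = - (m * r * D).
  have aux (r' D' : R) : r' = (a ^+ 2 - b ^+ 2) / 2 ->
      - (D' * (a ^+ 2 * b ^+ 2) * (a - b)) = - (m * r' * D') * (a ^+ 3 + b ^+ 3).
    by move=> ->; rewrite /m; field; rewrite !gt_eqF.
  apply: (mulIf (lt0r_neq0 c0)); rewrite EQ (aux r D)// a2 b2.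
  by field.
(* Since b <= a, the denominator of m is at most (2 a) (2 a^3). *)
have bm : b ^+ 2 <= 2 * a ^+ 2 * m.
  rewrite /m mulrA ler_pdivlMr; last exact: mulr_gt0.
  rewrite [leRHS](_ : _ = b ^+ 2 * ((a + a) * (a ^+ 3 + a ^+ 3))); last by ring.
  rewrite ler_pM2l ?exprn_gt0//; apply: ler_pM; try exact: ltW.
    by rewrite lerD2l.
  by rewrite lerD2l ler_pXn2r// nnegrE ltW.
have det_le : s * u - t ^+ 2 <= - (m * D ^+ 2).
  (* The determinant of the form in the frame (p, q), (- q, p), whose vectors have
     square norm r. *)
  have E : r ^+ 2 * (s * u - t ^+ 2) =
     Q * (r * D - Q) - (p * q * (u - s) + (p ^+ 2 - q ^+ 2) * t) ^+ 2.
    by rewrite /Q /D /r; ring.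
  have r2 : 0 < r ^+ 2 by rewrite exprn_gt0.
  rewrite -(ler_pM2l r2) E Qm.
  have -> : - (m * r * D) * (r * D - - (m * r * D)) = r ^+ 2 * - (m * D ^+ 2) - (m * r * D) ^+ 2.
    ring.
  by rewrite -addrA gerDl -opprD oppr_le0 addr_ge0// sqr_ge0.
have D2 : 0 <= D ^+ 2 by rewrite sqr_ge0.
have a20 : 0 < 2 * a ^+ 2 by rewrite mulr_gt0// exprn_gt0.
have := ler_wpM2r D2 bm; have := ler_wpM2l (ltW a20) det_le.
move: (a ^+ 2) (b ^+ 2) (D ^+ 2) (s * u - t ^+ 2) => A B D' d.
lra.
Qed.

Lemma indefinite_form s t u : s * u - t ^+ 2 < 0 ->
  exists x y, x ^+ 2 * s + 2 * x * y * t + y ^+ 2 * u < 0.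
Proof.
move=> d0; have [s0|s0|s0] := ltgtP s 0.
- by exists 1, 0; rewrite expr1n expr0n/=; lra.
(* For s > 0 the vector (- t, s) is orthogonal to the first axis for the form. *)
- exists (- t), s.
  rewrite (_ : _ + _ + _ = s * (s * u - t ^+ 2)); last by ring.
  by rewrite pmulr_rlt0.
have t0 : t != 0 by apply: contraTneq d0 => ->; rewrite s0 mul0r expr0n subrr ltxx.
(* For s = 0 the form is affine in x on the line y = 1; x gives it the value -1. *)
exists (- (u + 1) / (2 * t)), 1; rewrite s0.
rewrite (_ : _ + _ + _ = -1); first by rewrite oppr_lt0 ltr01.
by field.
Qed.

End Algebra.

(** * Height above the tangent plane *)

Section Nonconvex.
Context {R : realType}.

Lemma is_derive_height (c p q : R) (g0 g1 g2 : R^o -> R) a0 a1 a2 (t : R^o) :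
  is_derive t (1 : R^o) g0 a0 -> is_derive t (1 : R^o) g1 a1 -> is_derive t (1 : R^o) g2 a2 ->
  is_derive t (1 : R^o) (fun t => c * (g2 t - p * g0 t - q * g1 t) : R)
    (c * (a2 - p * a0 - q * a1)).
Proof.
move=> d0 d1 d2.
have -> : (fun t => c * (g2 t - p * g0 t - q * g1 t) : R) =
  cst c * (g2 - cst p * g0 - cst q * g1) by apply/funext.
apply: is_derive_eq; rewrite /cst /GRing.scale /=; ring.
Qed.

Lemma is_derive_comb (w0 w1 : R) (h0 h1 : R^o -> R) a0 a1 (t : R^o) :
  is_derive t (1 : R^o) h0 a0 -> is_derive t (1 : R^o) h1 a1 ->
  is_derive t (1 : R^o) (fun t => w0 * h0 t + w1 * h1 t : R) (w0 * a0 + w1 * a1).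
Proof.
move=> d0 d1.
exact: (is_deriveD (is_deriveZ w0 d0) (is_deriveZ w1 d1)).
Qed.

Context (X : 'rV[R]_2 -> 'rV[R]_3) (U : set 'rV[R]_2).
Context (oU : open U) (smX : smooth_on U X) (jac0 : forall s, U s -> jac X s != 0).

Lemma is_derive_param_line s w t k : U (line s w t) ->
  is_derive t (1 : R^o) (fun t => X (line s w t) 0 k)
    (w 0 0 * partial X 0 k (line s w t) + w 0 1 * partial X 1 k (line s w t)).
Proof.
move=> Ut; rewrite -(diff_partial smX _ _ Ut).
apply: is_derive_coord; apply: is_derive_comp.
- exact: differentiable_line.
- exact: is_derive1_line.
- exact: smooth_on_differentiable smX Ut.
Qed.

Lemma is_derive_partial_line s w j k : U s ->
  is_derive (0 : R^o) (1 : R^o) (fun t => partial X j k (line s w t))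
    (w 0 0 * partial2 X 0 j k s + w 0 1 * partial2 X 1 j k s).
Proof.
move=> Us; have dp := differentiable_partial smX j k Us.
have D i : 'd (partial X j k) s (ebase i) = partial2 X i j k s.
  by rewrite -deriveE//; exact: (@derive_val _ _ _ _ _ _ _ (is_derive_partial smX i j k Us)).
rewrite -!D -diff_ebase.
have dc := is_derive_comp (differentiable_line s w 0) (is_derive1_line s w 0).
by rewrite line0 in dc; exact: dc.
Qed.

Definition height p q (v : 'rV[R]_3) : R := v 0 ord_max - p * v 0 0 - q * v 0 1.

(** The first derivative of the height along the line of parameters vanishes at s, where
the plane is tangent, and the second one is the second fundamental form.  The
factor c, of either sign, selects the side of the tangent plane. *)
Lemma height_decreases (s w : 'rV[R]_2) (c : R) : U s ->
  c * (w 0 0 ^+ 2 * second_form X 0 0 s + 2 * w 0 0 * w 0 1 * second_form X 0 1 s +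
       w 0 1 ^+ 2 * second_form X 1 1 s) < 0 ->
  \forall t \near (0 : R)^'+,
    c * height (slope0 X s) (slope1 X s) (X (line s w t)) <
    c * height (slope0 X s) (slope1 X s) (X s).
Proof.
move=> Us; set p := slope0 X s; set q := slope1 X s => neg.
have E := line0 s w.
pose D k t := w 0 0 * partial X 0 k (line s w t) + w 0 1 * partial X 1 k (line s w t).
pose D2 k := w 0 0 * (w 0 0 * partial2 X 0 0 k s + w 0 1 * partial2 X 1 0 k s) +
             w 0 1 * (w 0 0 * partial2 X 0 1 k s + w 0 1 * partial2 X 1 1 k s).
have dD k : is_derive (0 : R^o) (1 : R^o) (D k) (D2 k).
  by apply: is_derive_comb; exact: is_derive_partial_line.
suff : \forall t \near (0 : R)^'+,
    c * height p q (X (line s w t)) < c * height p q (X (line s w 0)).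
  by apply: filterS => t; rewrite E.
have dh := is_derive_height c p q (dD 0) (dD 1) (dD ord_max).
apply: (@second_derivative_neg R (fun t => c * height p q (X (line s w t)))
  (fun t => c * (D ord_max t - p * D 0 t - q * D 1 t))
  (c * (D2 ord_max - p * D2 0 - q * D2 1))).
- have : nbhs (0 : R) (line s w @^-1` U).
    by apply: open_nbhs_nbhs; split; [exact: open_line | rewrite /preimage /= E].
  apply: filterS => t Ut; have d k := is_derive_param_line k Ut.
  exact: (is_derive_height c p q (d 0) (d 1) (d ord_max)).
- rewrite /D E (partial_slope 0 (jac0 Us)) (partial_slope 1 (jac0 Us)) -/p -/q.
  move: (partial X 0 0 s) (partial X 0 1 s) (partial X 1 0 s) (partial X 1 1 s) => a b a' b'.
  ring.
have S k : partial2 X 1 0 k s = partial2 X 0 1 k s by apply: (partial2C oU smX).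
move: neg; rewrite /D2 !S /second_form -/p -/q.
move: (partial2 X 0 0 0 s) (partial2 X 0 0 1 s) (partial2 X 0 0 ord_max s) => a0 a1 a2.
move: (partial2 X 0 1 0 s) (partial2 X 0 1 1 s) (partial2 X 0 1 ord_max s) => b0 b1 b2.
move: (partial2 X 1 1 0 s) (partial2 X 1 1 1 s) (partial2 X 1 1 ord_max s) => c0 c1 c2.
by congr (_ < 0); ring.
Qed.

End Nonconvex.

(** * Surfaces with equal mean curvatures *)

Section Curvatures.
Context {R : realType} (Sigma : set 'rV[R]_3) (U : set 'rV[R]_2) (V : set 'rV[R]_3)
  (X : 'rV[R]_2 -> 'rV[R]_3) (Y : 'rV[R]_3 -> 'rV[R]_2).
Context (spS : spacelike_surface Sigma) (XY : local_param Sigma U V X Y).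

Let oU : open U := param_open XY.
Let smX : smooth_on U X. Proof. by case: XY. Qed.
Let jac0 s : U s -> jac X s != 0. Proof. exact: spacelike_jac XY _. Qed.

Let p := slope0 X.
Let q := slope1 X.
Let S := graph_hess X.
Let D s := S 0 0 s + S 1 1 s.
Let Q s := p s ^+ 2 * S 0 0 s + p s * q s * (S 0 1 s + S 0 1 s) + q s ^+ 2 * S 1 1 s.

Lemma N_R_param s : U s -> N_R Sigma (X s) = unit_normal 1 (p s) (q s).
Proof. by move=> Us; apply: N_R_graph; exact: tangent_space_graph XY _ Us. Qed.

Lemma N_L_param s : U s -> N_L Sigma (X s) = unit_normal (- 1) (p s) (q s).
Proof.
move=> Us; apply: N_L_graph; first exact: (slope_lt1 spS XY).
exact: tangent_space_graph XY _ Us.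
Qed.

Lemma curvatures_param s : U s -> exists a b : R,
  [/\ 0 < a /\ 0 < b,
      a ^+ 2 = 1 + (p s ^+ 2 + q s ^+ 2) /\ b ^+ 2 = 1 - (p s ^+ 2 + q s ^+ 2),
      H_R Sigma (X s) = 2^-1 * (D s / a - Q s / a ^+ 3),
      H_L Sigma (X s) = 2^-1 * (D s / b + Q s / b ^+ 3) &
      K_R Sigma (X s) = (S 0 0 s * S 1 1 s - S 0 1 s ^+ 2) / a ^+ 4].
Proof.
move=> Us; have r1 := slope_lt1 spS XY Us.
have W1 : 0 < 1 + 1 * (p s ^+ 2 + q s ^+ 2) by rewrite mul1r ltr_pwDl// addr_ge0// sqr_ge0.
have W2 : 0 < 1 + (- 1) * (p s ^+ 2 + q s ^+ 2) by rewrite mulN1r subr_gt0.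
have e1 : 1 ^+ 2 = 1 :> R by rewrite expr1n.
have em : (- 1) ^+ 2 = 1 :> R by rewrite sqrrN expr1n.
have [a0 _ a2] := slope_factorP W1; have [b0 _ b2] := slope_factorP W2.
exists (slope_factor 1 (p s) (q s)), (slope_factor (- 1) (p s) (q s)).
have [trR detR] := shape_operator spS XY e1 Us W1 N_R_param.
have [trL _] := shape_operator spS XY em Us W2 N_L_param.
have SC : S 1 0 s = S 0 1 s by apply: (graph_hessC oU smX).
split=> //.
- by rewrite a2 b2 mul1r mulN1r.
- by rewrite /H_R [restr_tr _ _]trR mul1r -/S SC.
- rewrite /H_L [restr_tr _ _]trL -/S SC -mulrN mulN1r mulNr opprD !opprK.
  by [].
- by rewrite /K_R [restr_det _ _]detR -/S SC expr2.
Qed.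

Context (HRL : forall x, Sigma x -> H_R Sigma x = H_L Sigma x).

(** The left-hand side of [hessian_det_le]. *)
Let defect s :=
  2 * (1 + (p s ^+ 2 + q s ^+ 2)) * (S 0 0 s * S 1 1 s - S 0 1 s * S 0 1 s) +
  (1 - (p s ^+ 2 + q s ^+ 2)) * (D s * D s).

Lemma defect_slope s : U s -> p s ^+ 2 + q s ^+ 2 != 0 -> defect s <= 0.
Proof.
move=> Us r0; have [a [b [[a0 b0] [a2 b2] HR HL _]]] := curvatures_param Us.
have := HRL (param_in XY Us); rewrite HR HL => /mulfI.
rewrite invr_eq0 pnatr_eq0 => /(_ isT) E.
have EQ := mean_curvature_eq (lt0r_neq0 a0) (lt0r_neq0 b0) E.
have := hessian_det_le a0 b0 a2 b2 EQ r0.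
by rewrite /defect a2 b2 !expr2.
Qed.

Lemma continuous_defect s : U s -> {for s, continuous defect}.
Proof.
move=> Us; have cS i j : {for s, continuous (S i j)} by exact: continuous_graph_hess Us.
have cp : {for s, continuous p} by exact: continuous_slope0 Us.
have cq : {for s, continuous q} by exact: continuous_slope1 Us.
have c1 (x : R) : {for s, continuous (fun=> x)} by exact: (@cst_continuous _ R^o x s).
have cr : {for s, continuous (fun s => p s ^+ 2 + q s ^+ 2)}.
  by apply: continuous_atD; exact: continuous_atM.
have cD : {for s, continuous D} by apply: continuous_atD.
rewrite /defect; apply: continuous_atD.
  apply: continuous_atM; first by apply: continuous_atM => //; exact: continuous_atD.
  by apply: continuous_atB; exact: continuous_atM.
by apply: continuous_atM; [exact: continuous_atB|exact: continuous_atM].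
Qed.

(** Where the gradient does not vanish this is [defect_slope].  A point where the
defect is positive has a neighbourhood on which it is positive, hence on which
the gradient vanishes identically; then S = 0 at that point and the defect is 0. *)
Lemma defect_le0 s : U s -> defect s <= 0.
Proof.
move=> Us; rewrite leNgt; apply/negP => pos.
have n0 : \forall u \near s, p u = 0 /\ q u = 0.
  have nU : \forall u \near s, U u by exact: open_nbhs_nbhs.
  have npos : \forall u \near s, 0 < defect u.
    by exact: (cvgr_gt _ (continuous_defect Us)).
  near=> u; have Uu : U u by near: u.
  have /eqP : p u ^+ 2 + q u ^+ 2 == 0.
    apply/negPn/negP => /(defect_slope Uu); rewrite leNgt; apply/negP; rewrite negbK.
    by near: u.
  move=> /eqP; rewrite paddr_eq0 ?sqr_ge0// !sqrf_eq0 => /andP[/eqP -> /eqP ->].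
  by [].
have flat (f : 'rV[R]_2 -> R) v :
    differentiable f s -> (\forall u \near s, f u = 0) -> 'd f s v = 0.
  move=> df f0; rewrite -deriveE// (near_eq_derive (g := cst 0))//.
  exact: derive_cst.
have [dp dq] := differentiable_slope smX jac0 Us.
have p0 v : 'd p s v = 0 by apply: flat => //; apply: filterS n0 => u [].
have q0 v : 'd q s v = 0 by apply: flat => //; apply: filterS n0 => u [].
have S0 a : S a 0 s = 0 /\ S a 1 s = 0.
  have zero (x y z t : R) : z = 0 -> t = 0 -> x * z + y * t = 0.
    by move=> -> ->; rewrite !mulr0 addr0.
  have [E0 E1] := graph_hess_slope oU smX jac0 a Us.
  by split; [exact: etrans E0 (zero _ _ _ _ (p0 _) (p0 _))
            |exact: etrans E1 (zero _ _ _ _ (q0 _) (q0 _))].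
have [S00 S01] := S0 0; have [_ S11] := S0 1.
by move: pos; rewrite /defect /D S00 S01 S11 !(addr0, mulr0, subr0) ltxx.
Unshelve. all: by end_near. Qed.

Lemma locally_nonconvex_param s : U s -> S 0 0 s * S 1 1 s - S 0 1 s ^+ 2 < 0 ->
  locally_nonconvex Sigma (X s).
Proof.
move=> Us det0 [V' nV' half].
have [a0 _ _] : [/\ 0 < slope_factor 1 (p s) (q s), slope_factor 1 (p s) (q s) != 0 &
   slope_factor 1 (p s) (q s) ^+ 2 = 1 + 1 * (p s ^+ 2 + q s ^+ 2)].
  by apply: slope_factorP; rewrite mul1r ltr_pwDl// addr_ge0// sqr_ge0.
have dotE x : dotR (x - X s) (N_R Sigma (X s)) =
    (slope_factor 1 (p s) (q s))^-1 * (height (p s) (q s) x - height (p s) (q s) (X s)).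
  rewrite N_R_param// /dotR /x3 /height !mxE/=; ring.
have key c (x y : R) :
    c * (x ^+ 2 * S 0 0 s + 2 * x * y * S 0 1 s + y ^+ 2 * S 1 1 s) < 0 ->
    exists x, (Sigma `&` V') x /\ c * dotR (x - X s) (N_R Sigma (X s)) < 0.
  rewrite -(second_form_plane_lift oU smX x y Us) => neg.
  have := height_decreases oU smX jac0 Us neg; rewrite -/p -/q.
  set w := plane_lift X s x y => dec.
  have nl : \forall t \near (0 : R), U (line s w t) /\ V' (X (line s w t)).
    have nUV : \forall u \near s, U u /\ V' (X u).
      near=> u; split; first by near: u; exact: open_nbhs_nbhs.
      near: u; apply: (differentiable_continuous (param_differentiable XY Us)).
      exact: nV'.
    have := differentiable_continuous (differentiable_line s w 0).
    by move/(_ [set u | U u /\ V' (X u)]); rewrite line0 => /(_ nUV).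
  have nl' : \forall t \near (0 : R)^'+, U (line s w t) /\ V' (X (line s w t)).
    exact: cvg_within nl.
  have : \forall t \near (0 : R)^'+, c * height (p s) (q s) (X (line s w t)) <
      c * height (p s) (q s) (X s) /\ U (line s w t) /\ V' (X (line s w t)).
    by near=> t; split; near: t.
  move=> /(@filter_ex _ _ (at_right_proper_filter 0))[t [dt [Ut Vt]]].
  exists (X (line s w t)); split; first by have := param_in XY Ut.
  by rewrite dotE mulrCA pmulr_rlt0 ?invr_gt0// mulrBr subr_lt0.
case: half => half.
  have [x [y neg]] := indefinite_form det0.
  have [|z [/half]] := key 1 x y; first by rewrite mul1r.
  by rewrite /upper_half_space /= mul1r leNgt => /negP.
have [|x [y neg]] := @indefinite_form R (- S 0 0 s) (- S 0 1 s) (- S 1 1 s).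
  by rewrite mulrNN sqrrN.
have [|z [/half]] := key (- 1) x y.
  by rewrite mulN1r !opprD -!mulrN.
by rewrite /lower_half_space /= mulN1r oppr_lt0 leNgt => /negP.
Unshelve. all: by end_near. Qed.

End Curvatures.

Theorem theorem4 (R : realType) (Sigma : set 'rV[R]_3)
    (spacelikeS : spacelike_surface Sigma)
    (HRL : forall p, Sigma p -> H_R Sigma p = H_L Sigma p) :
  [/\ forall p, Sigma p -> K_R Sigma p <= 0,
      forall p, Sigma p -> K_R Sigma p = 0 -> H_R Sigma p = 0 &
      forall p, Sigma p -> H_R Sigma p != 0 -> locally_nonconvex Sigma p].
Proof.
have chart x : Sigma x -> exists U V X Y s, [/\ local_param Sigma U V X Y, U s & X s = x].
  move=> Sx; have [[_ /(_ x Sx)[U [V [X [Y [XY Vx]]]]]] _] := spacelikeS.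
  have [_ _ imX _ _] := XY; have : (Sigma `&` V) x by [].
  by rewrite -imX => -[s Us <-]; exists U, V, X, Y, s.
(* d is det S, and a is (1 + r2)^2. *)
have main x : Sigma x -> exists (a d : R),
   [/\ K_R Sigma x = d / a, 0 < a, d <= 0, (d = 0 -> H_R Sigma x = 0) &
       d < 0 -> locally_nonconvex Sigma x].
  move=> /chart[U [V [X [Y [s [XY Us <-]]]]]].
  have [a [b [[a0 b0] [a2 b2] HR HL HK]]] := curvatures_param spacelikeS XY Us.
  have le0 := defect_le0 spacelikeS XY HRL Us.
  exists (a ^+ 4), (graph_hess X 0 0 s * graph_hess X 1 1 s - graph_hess X 0 1 s ^+ 2).
  have r1 := slope_lt1 spacelikeS XY Us.
  have D0 : 0 <= (graph_hess X 0 0 s + graph_hess X 1 1 s) ^+ 2 by rewrite sqr_ge0.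
  have b20 : 0 < b ^+ 2 by rewrite exprn_gt0.
  have a20 : 0 < 2 * a ^+ 2 by rewrite mulr_gt0// exprn_gt0.
  rewrite -a2 -b2 -!expr2 in le0.
  split=> //.
  - by rewrite exprn_gt0.
  - rewrite -(pmulr_rle0 _ a20); apply: le_trans le0.
    by rewrite lerDl mulr_ge0// ltW.
  - move=> d0; rewrite d0 mulr0 add0r pmulr_rle0// in le0.
    have /eqP : (graph_hess X 0 0 s + graph_hess X 1 1 s) ^+ 2 == 0.
      by rewrite eq_le le0 D0.
    move=> /eqP; rewrite sqrf_eq0 => /eqP tr0.
    have := HRL _ (param_in XY Us); rewrite HR HL => /mulfI.
    rewrite invr_eq0 pnatr_eq0 => /(_ isT) E.
    have := mean_curvature_eq (lt0r_neq0 a0) (lt0r_neq0 b0) E.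
    rewrite tr0 !mul0r oppr0 => /eqP.
    rewrite mulf_eq0 [X in _ || X]gt_eqF ?addr_gt0 ?exprn_gt0// orbF => /eqP ->.
    by rewrite !mul0r subrr mulr0.
  - exact: (locally_nonconvex_param spacelikeS XY).
split=> x /main[a [d [EK a0 d0 d0H dneg]]].
- by rewrite EK pmulr_lle0 ?invr_gt0.
- by move/eqP; rewrite EK mulf_eq0 invr_eq0 (gt_eqF a0) orbF => /eqP.
by move=> H0; apply: dneg; rewrite lt_neqAle d0 andbT; apply: contra_neq H0.
Qed.
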